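(* Let $(M^{4n},Q,\omega)$, $n>1$, be a quaternionic skew-Hermitian manifold with Swann bundle $\hat\pi:\hat M\to M$, almost hypercomplex structure $\hat H=(\hat I_1,\hat I_2,\hat I_3)$ on $\hat M$ and 1-forms $\alpha_0,\alpha_1,\alpha_2,\alpha_3$ on $\hat M$ as defined in the context. At any point $p\in\hat M$, the space of all $\hat H$-Hermitian 2-forms $\beta$ with $\beta|_{\hat{\mathcal H}_p\times\hat{\mathcal H}_p}=0$ and $\beta|_{\hat{\mathcal H}_p\times\hat{\mathcal V}_p}=0$ is 3-dimensional, generated by the 2-forms $$\beta_a=\alpha_0\wedge\alpha_a+\alpha_b\wedge\alpha_c$$ for any cyclic permutation $(a,b,c)$ of $(1,2,3)$.
   Context: All manifolds are smooth and connected. An almost quaternionic structure on $M^{4n}$ is a rank-3 subbundle $Q\subset\mathrm{End}(TM)$ locally spanned by an admissible frame $I_1,I_2,I_3$ with $I_1^2=I_2^2=I_3^2=-\mathrm{Id}=I_1I_2I_3$. A scalar 2-form with respect to $Q$ is a non-degenerate 2-form $\omega$ with $\omega(I_aX,I_aY)=\omega(X,Y)$. $(M,Q,\omega)$ is a quaternionic skew-Hermitian manifold if there is a (necessarily unique) torsion-free connection $\nabla=\nabla^{Q,\omega}$ preserving $Q$ with $\nabla\omega=0$. Swann bundle. Let $\pi_S:S\to M$ be the principal $\mathrm{SO}(3)$-bundle (right action) of admissible frames $s=(I_1,I_2,I_3)$ of $Q$, $I_1I_2=I_3$, and $S_0=(\wedge^{4n}T^*M\setminus\{0\})/\mathbb{Z}_2$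 the principal $\mathbb{R}_+$-bundle of volume forms up to sign, trivialized as $S_0=M\times\mathbb{R}_+$ by the $\nabla$-parallel section $\omega^{2n}$, with fibre coordinate $t$. The Swann bundle is $\hat M=S_0\times_MS\cong\mathbb{R}_+\times S$, a principal bundle over $M$ with group $\mathbb{R}_+\times\mathrm{SO}(3)\cong\mathbb{H}^\times/\mathbb{Z}_2$ and projection $\hat\pi$. The Lie algebra $\mathbb{H}=\mathbb{R}\oplus\mathfrak{sp}(1)$ has basis $e_0=1$, $(e_1,e_2,e_3)=(i,j,k)$, with $[e_a,e_b]=2e_c$ for cyclic $(a,b,c)$. Let $\theta=\sum_a\theta_ae_a:TS\to\mathfrak{sp}(1)\cong\mathfrak{so}(3)$ be the connection form on $S$ induced by $\nabla$; on $\hat M$ we have the connection form $\hat\theta=t^{-1}dt+\theta$. Put $\hat{\mathcal V}=\ker d\hat\pi$, $\hat{\mathcal H}=\ker\hat\theta$, and let $Z_0,\dots,Z_3$ be the fundamental vector fields of $e_0,\dots,e_3$. Define $\hat I_a$, for $(a,b,c)$ a cyclic permutation of $(1,2,3)$, by $\hat I_aZ_0=-Z_a$, $\hat I_aZ_a=Z_0$, $\hat I_aZ_b=Z_c$, $\hat I_aZ_c=-Z_b$, and, at a point $u$ with $S$-component $s=(I_1,I_2,I_3)$, $(\hat I_a)_u(Y)=$ the horizontal lift to $\hat{\mathcal H}_u$ of $I_a(\hat\pi_*Y)$ for $Y\in\hat{\mathcal H}_u$. A 2-form $\beta$ is $\hat H$-Hermitian if $\beta(\hat I_aX,\hat I_aY)=\beta(X,Y)$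 for $a=1,2,3$. Finally $\alpha:=\frac1t\hat\theta=\alpha_0+\alpha_1e_1+\alpha_2e_2+\alpha_3e_3$, i.e. $\alpha_0=\frac{1}{t^2}dt$ and $\alpha_a=\frac1t\theta_a$ for $a=1,2,3$. *)

(* Defs.v *)
From HB Require Import structures.
From mathcomp Require Import all_boot all_order all_algebra.
From mathcomp Require Import all_classical all_reals all_analysis.

Set Implicit Arguments.
Unset Strict Implicit.
Unset Printing Implicit Defensive.

Import Order.TTheory GRing.Theory Num.Theory.
Import numFieldNormedType.Exports.

Local Open Scope classical_set_scope.
Local Open Scope ring_scope.

(* C^k on an open set U of a finite-dimensional space V *)
Fixpoint Ck (R : realType) (V W : normedModType R) (k : nat)
    (U : set V) (f : V -> W) : Prop :=
  match k with
  | 0 => forall x, U x -> {for x, continuous f}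
  | k'.+1 => (forall x, U x -> differentiable f x) /\
             (forall v : V, Ck k' U (fun x => 'D_v f x))
  end.

Definition smooth_on (R : realType) (V W : normedModType R)
    (U : set V) (f : V -> W) : Prop := forall k, Ck k U f.

(* A connected smooth manifold without boundary.  The atlas is indexed by the
   points, [chart x] being a chosen chart around [x]; every smooth structure
   can be presented in this way. *)
Record manifold (R : realType) (d : nat) := Manifold {
  points :> topologicalType;
  cdom : points -> set points;
  chart : points -> points -> 'cV[R]_d;
  chart_inv : points -> 'cV[R]_d -> points;
  cdom_refl : forall x, cdom x x;
  cdom_open : forall x, open (cdom x);
  chart_open : forall x, open (chart x @` cdom x);
  chartK : forall x y, cdom x y -> chart_inv x (chart x y) = y;
  chart_continuous : forall x y, cdom x y -> {for y, continuous (chart x)};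
  chart_inv_continuous : forall x z, (chart x @` cdom x) z ->
    {for z, continuous (chart_inv x)};
  chart_smooth : forall x y,
    smooth_on (chart x @` (cdom x `&` cdom y))
              (fun z => chart y (chart_inv x z));
  points_hausdorff : hausdorff_space points;
  points_second_countable : @second_countable points;
  points_connected : connected [set: points] }.

Arguments cdom {R d m}.
Arguments chart {R d m}.
Arguments chart_inv {R d m}.

(* [T_p M] is represented by ['cV[R]_d], a tangent vector at [p] being given by
   its components in the chart [chart p].  Accordingly a vector field is a
   function [M -> 'cV_d], a field of endomorphisms a function [M -> 'M_d]
   (acting by [A p *m v]), and a bilinear form a function [M -> 'M_d]
   (with [form2 (w p) v v' = v^T w(p) v']); smoothness is always read in the
   charts. *)

Section Tensors.
Context {R : realType} {d : nat} {M : manifold R d}.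
Implicit Types (x y p q : M) (U : set M).

(* Jacobian, at the point q, of the change of coordinates from chart x to
   chart y *)
Definition jac x y q : 'M[R]_d :=
  \matrix_(i, j)
    ('D_(delta_mx j 0) (fun z => chart y (chart_inv x z)) (chart x q) i 0).

Definition form2 (w : 'M[R]_d) (v v' : 'cV[R]_d) : R :=
  (v^T *m w *m v') 0 0.

Definition fun_in x (f : M -> R) (z : 'cV[R]_d) : R := f (chart_inv x z).

Definition vf_in x (Y : M -> 'cV[R]_d) (z : 'cV[R]_d) : 'cV[R]_d :=
  let q := chart_inv x z in jac q x q *m Y q.

Definition end_in x (A : M -> 'M[R]_d) (z : 'cV[R]_d) : 'M[R]_d :=
  let q := chart_inv x z in jac q x q *m A q *m jac x q q.

Definition form_in x (w : M -> 'M[R]_d) (z : 'cV[R]_d) : 'M[R]_d :=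
  let q := chart_inv x z in (jac x q q)^T *m w q *m jac x q q.

Definition smooth_fun U (f : M -> R) : Prop :=
  forall x, smooth_on (chart x @` (U `&` cdom x)) (fun_in x f).
Definition smooth_vf U (Y : M -> 'cV[R]_d) : Prop :=
  forall x, smooth_on (chart x @` (U `&` cdom x)) (vf_in x Y).
Definition smooth_end U (A : M -> 'M[R]_d) : Prop :=
  forall x, smooth_on (chart x @` (U `&` cdom x)) (end_in x A).
Definition smooth_form U (w : M -> 'M[R]_d) : Prop :=
  forall x, smooth_on (chart x @` (U `&` cdom x)) (form_in x w).

Definition dfun p (v : 'cV[R]_d) (f : M -> R) : R :=
  'D_v (fun_in p f) (chart p p).

Definition lie_bracket (X Y : M -> 'cV[R]_d) p : 'cV[R]_d :=
  'D_(X p) (vf_in p Y) (chart p p) - 'D_(Y p) (vf_in p X) (chart p p).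

(* [nabla p v Y] is the covariant derivative at [p] in the direction [v]; only
   its values on fields [Y] that are smooth near [p] are meaningful.  Taking
   [f] to be the indicator function of a neighbourhood of [p] in the Leibniz
   rule shows that it depends only on the germ of [Y] at [p]. *)

Definition connection_op := M -> 'cV[R]_d -> (M -> 'cV[R]_d) -> 'cV[R]_d.

Record is_connection (nabla : connection_op) : Prop := IsConnection {
  nabla_linear : forall U p a v w Y, open U -> U p -> smooth_vf U Y ->
    nabla p (a *: v + w) Y = a *: nabla p v Y + nabla p w Y;
  nabla_add : forall U p v Y Z, open U -> U p ->
    smooth_vf U Y -> smooth_vf U Z ->
    nabla p v (fun q => Y q + Z q) = nabla p v Y + nabla p v Z;
  nabla_leibniz : forall U p v f Y, open U -> U p ->
    smooth_fun U f -> smooth_vf U Y ->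
    nabla p v (fun q => f q *: Y q) = dfun p v f *: Y p + f p *: nabla p v Y;
  nabla_smooth : forall U X Y, open U -> smooth_vf U X -> smooth_vf U Y ->
    smooth_vf U (fun q => nabla q (X q) Y) }.

Definition torsion_free (nabla : connection_op) : Prop :=
  forall U p X Y, open U -> U p -> smooth_vf U X -> smooth_vf U Y ->
    nabla p (X p) Y - nabla p (Y p) X = lie_bracket X Y p.

Definition parallel_form (nabla : connection_op) (w : M -> 'M[R]_d) : Prop :=
  forall U p v Y Z, open U -> U p -> smooth_vf U Y -> smooth_vf U Z ->
    dfun p v (fun q => form2 (w q) (Y q) (Z q)) =
    form2 (w p) (nabla p v Y) (Z p) + form2 (w p) (Y p) (nabla p v Z).

(* B = (nabla_v A)_p, for an endomorphism field A *)
Definition is_nabla_end (nabla : connection_op) p (v : 'cV[R]_d)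
    (A : M -> 'M[R]_d) (B : 'M[R]_d) : Prop :=
  forall U Y, open U -> U p -> smooth_vf U Y ->
    nabla p v (fun q => A q *m Y q) - A p *m nabla p v Y = B *m Y p.

Definition preserves (nabla : connection_op) (Q : M -> set 'M[R]_d) : Prop :=
  forall U p v A, open U -> U p -> smooth_end U A ->
    (forall q, U q -> Q q (A q)) ->
    exists2 B, Q p B & is_nabla_end nabla p v A B.

(* The endomorphism Gamma(v) of T_p M, w |-> nabla_v W, where W is the
   field with constant components w in the chart around p. *)
Definition christoffel (nabla : connection_op) p (v : 'cV[R]_d) : 'M[R]_d :=
  \matrix_(i, j) nabla p v (fun q => col j (jac p q q)) i 0.

(* The indices 1, 2, 3 are represented by ['I_3], that is Z/3, so that [a],
   [a + 1], [a + 2] is a cyclic permutation. *)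

Definition quaternion_rel (I : 'I_3 -> 'M[R]_d) : Prop :=
  (forall a, I a *m I a = - 1%:M) /\ I 0 *m I 1 *m I 2 = - 1%:M.

Definition almost_quaternionic (Q : M -> set 'M[R]_d) : Prop :=
  forall p, exists U, exists I : 'I_3 -> M -> 'M[R]_d,
    [/\ open U, U p, (forall a, smooth_end U (I a)) &
     forall q, U q -> quaternion_rel (fun a => I a q) /\
       Q q = [set A | exists x : 'I_3 -> R, A = \sum_a x a *: I a q]].

Definition admissible (Q : M -> set 'M[R]_d) p (I : 'I_3 -> 'M[R]_d) : Prop :=
  (forall a, Q p (I a)) /\ quaternion_rel I.

Record scalar_2form (Q : M -> set 'M[R]_d) (w : M -> 'M[R]_d) : Prop :=
  Scalar2Form {
    scalar_smooth : smooth_form setT w;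
    scalar_skew : forall p, (w p)^T = - w p;
    scalar_nondegenerate : forall p, w p \in unitmx;
    scalar_invariant : forall p I, admissible Q p I ->
      forall a v v', form2 (w p) (I a *m v) (I a *m v') = form2 (w p) v v' }.

Definition adapted_connection (Q : M -> set 'M[R]_d) (w : M -> 'M[R]_d)
    (nabla : connection_op) : Prop :=
  [/\ is_connection nabla, torsion_free nabla, preserves nabla Q &
      parallel_form nabla w].

Definition quaternionic_skew_hermitian (Q : M -> set 'M[R]_d)
    (w : M -> 'M[R]_d) : Prop :=
  [/\ almost_quaternionic Q, scalar_2form Q w &
      exists nabla, adapted_connection Q w nabla].

End Tensors.

Arguments connection_op {R d} M.

(* A point of the ambient manifold R x End(TM)^3 of the Swann bundle. *)
Record frame_point (R : realType) (d : nat) (M : manifold R d) := FramePoint {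
  fbase : M;
  fscale : R;
  fframe : {ffun 'I_3 -> 'M[R]_d} }.

(* Tangent vectors of R x End(TM)^3 at u, in the coordinates [coords (fbase u)]
   defined below: (dt, velocity of the base point, velocity of the frame). *)
Definition ambient (R : realType) (d : nat) :=
  (R^o * 'cV[R]_d * {ffun 'I_3 -> 'M[R]_d})%type.

Section Swann.
Context {R : realType} {d : nat} {M : manifold R d}.
Variables (Q : M -> set 'M[R]_d) (nabla : connection_op M).

Local Notation point := (frame_point M).
Local Notation E := (ambient R d).
Implicit Types (u : point) (X Y Z : E).

(* The Swann bundle R_+ x S, t being the coordinate in the trivialization of
   S_0 by the parallel section w^(2n).  As S is a subbundle of End(TM)^3, it is
   an embedded submanifold of R x End(TM)^3. *)
Definition swann u : Prop :=
  [/\ 0 < fscale u, admissible Q (fbase u) (fframe u) &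
      fframe u 0 *m fframe u 1 = fframe u 2].

Definition coords (p : M) u : E :=
  let q := fbase u in
  (fscale u, chart p q, [ffun a => jac q p q *m fframe u a *m jac p q q]).

Definition smooth_curve u (c : R -> point) : Prop :=
  c 0 = u /\ exists2 e : R, 0 < e &
    let J := [set r : R | `|r| < e] in
    let p := fbase u in
    [/\ (forall r, J r -> swann (c r) /\ cdom p (fbase (c r))),
        smooth_on J (fun r => (coords p (c r)).1.1 : R),
        smooth_on J (fun r => (coords p (c r)).1.2) &
        forall a, smooth_on J (fun r => (coords p (c r)).2 a)].

Definition velocity u (c : R -> point) : E :=
  let p := fbase u in
  ('D_1 (fun r => (coords p (c r)).1.1 : R) (0 : R),
   'D_1 (fun r => (coords p (c r)).1.2) (0 : R),
   [ffun a => 'D_1 (fun r => (coords p (c r)).2 a) (0 : R)]).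

Definition tangent u : set E :=
  [set X | exists2 c, smooth_curve u c & X = velocity u c].

(* Differential at u of the projection to M; its value is expressed in the
   chart [chart (fbase u)] *)
Definition dproj X : 'cV[R]_d := X.1.2.

(* Right action of the quaternion q0 + q 0 i + q 1 j + q 2 k, through
   H^x / Z_2 = R_+ x SO(3), (|q|, Ad q): viewing the frame s as the algebra
   morphism H -> End(T_p M) with s(e_a) = I_a, s . q is x |-> s(q x q^-1). *)
Definition qact u (q0 : R) (q : 'I_3 -> R) : point :=
  let N := q0 ^+ 2 + \sum_a q a ^+ 2 in
  let s := \sum_a q a *: fframe u a in
  FramePoint (fbase u) (Num.sqrt N * fscale u)
    [ffun b => N^-1 *: ((q0%:M + s) *m fframe u b *m (q0%:M - s))].

(* Fundamental vector fields: velocities of r |-> u . exp(r e_i) *)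
Definition Z0 u : E := velocity u (fun r => qact u (expR r) (fun=> 0)).
Definition Zi u (a : 'I_3) : E :=
  velocity u (fun r => qact u (cos r) (fun b => if b == a then sin r else 0)).

(* Covariant derivative along X of the frame: nabla_r I_a = I_a' + [Gamma, I_a] *)
Definition cov_frame u X : {ffun 'I_3 -> 'M[R]_d} :=
  let G := christoffel nabla (fbase u) (dproj X) in
  [ffun a => X.2 a + G *m fframe u a - fframe u a *m G].

(* The connection form induced by nabla: theta(X) is the element of sp(1) whose
   infinitesimal action on the frame is its covariant derivative along X. *)
Definition theta u X : {ffun 'I_3 -> R} :=
  xget 0 [set x : {ffun 'I_3 -> R} |
    cov_frame u X = \sum_a x a *: (Zi u a).2].

Definition theta0 u X : R := X.1.1 / fscale u.

Definition vertical u X : Prop := tangent u X /\ dproj X = 0.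

Definition horizontal u X : Prop :=
  [/\ tangent u X, theta0 u X = 0 & theta u X = 0].

Definition hlift u (v : 'cV[R]_d) : E :=
  xget 0 [set X | horizontal u X /\ dproj X = v].

(* The almost hypercomplex structure: a tangent vector is the sum of
   theta0 Z_0 + \sum_a theta_a Z_a and of its horizontal part, which has the
   same projection to M. *)
Definition Ihat u (a : 'I_3) X : E :=
  let b := a + 1 in let c := a + 2 in
  theta0 u X *: - Zi u a + theta u X a *: Z0 u
  + theta u X b *: Zi u c + theta u X c *: - Zi u b
  + hlift u (fframe u a *m dproj X).

Definition alpha0 u X : R := X.1.1 / fscale u ^+ 2.
Definition alphai u (a : 'I_3) X : R := theta u X a / fscale u.

Definition wedge (f g : E -> R) X Y : R := f X * g Y - f Y * g X.

Definition beta_ u (a : 'I_3) X Y : R :=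
  wedge (alpha0 u) (alphai u a) X Y
  + wedge (alphai u (a + 1)) (alphai u (a + 2)) X Y.

(* Functions on E x E represent forms on [tangent u]: only their values on
   tangent vectors matter. *)
Definition two_form u (b : E -> E -> R) : Prop :=
  (forall (k : R) X Y Z, tangent u X -> tangent u Y -> tangent u Z ->
     b (k *: X + Y) Z = k * b X Z + b Y Z) /\
  (forall X Y, tangent u X -> tangent u Y -> b X Y = - b Y X).

Definition hermitian u (b : E -> E -> R) : Prop :=
  forall a X Y, tangent u X -> tangent u Y ->
    b (Ihat u a X) (Ihat u a Y) = b X Y.

Definition vertical_hermitian u (b : E -> E -> R) : Prop :=
  [/\ two_form u b, hermitian u b,
      (forall X Y, horizontal u X -> horizontal u Y -> b X Y = 0) &
      (forall X Y, horizontal u X -> vertical u Y -> b X Y = 0)].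

End Swann.

(* Main.v *)
(* Proof idea.  In terms of the scale form theta_0 and the connection form
   theta, beta_a(X, Y) is, up to the factor t^-2,
     x_0 y_a - y_0 x_a + x_b y_c - x_c y_b,
   where x_i, y_i are the components of X, Y along Z_0, ..., Z_3; this is one of
   the standard 2-forms on H invariant under the three complex structures.
   Conversely, a form b vanishing on horizontal x arbitrary pairs is determined
   by the numbers b(Z_i, Z_j), and invariance under I_c, c = a + 2, gives
   b(Z_0, Z_a) = b(Z_b, Z_c), so that the three numbers b(Z_0, Z_a) determine it.

   This requires that theta is well defined, i.e. that the covariant derivative
   of a curve of admissible frames is an infinitesimal rotation of the frame:
   the frame is a combination of a local frame of Q, so that its covariant
   derivative has values in Q because nabla preserves Q, and differentiating the
   quaternion relations makes its matrix antisymmetric.  It also requires that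
   the vertical and horizontal parts of a tangent vector are tangent: acting on
   a curve by one-parameter subgroups of H^x adds multiples of the Z_i to its
   velocity. *)
Require Import Defs.
From HB Require Import structures.
From mathcomp Require Import all_boot all_order all_algebra.
From mathcomp Require Import all_classical all_reals all_analysis.
From mathcomp Require Import ring.
Import Order.TTheory GRing.Theory Num.Theory.
Import numFieldNormedType.Exports.
Local Open Scope classical_set_scope.
Local Open Scope ring_scope.

Set Implicit Arguments.
Unset Strict Implicit.
Unset Printing Implicit Defensive.

(** * Differential calculus of matrix-valued maps *)

(** The differential of [f] also approximates [g] to first order, so by uniqueness it is the
    differential of [g]. *)
Lemma near_eq_differentiable {R : realType} {V W : normedModType R}
    (f g : V -> W) x :
  {near x, f =1 g} -> differentiable f x -> differentiable g x.
Proof.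
move=> fg df.
have [dfc /eqaddoP dfo] := (diff_locallyP x f).1 df.
have dgo : g \o shift x = cst (g x) + 'd f x +o_ 0 id.
  apply/eqaddoP => e e0; have {}dfo := dfo e e0.
  have gx := nbhs_singleton fg; rewrite (near_shift 0) subr0 /= in fg.
  apply: filterS2 fg dfo => y /= fgy; rewrite !fctE /= gx.
  by rewrite -fgy.
by apply/diff_locallyP; rewrite (diff_unique dfc dgo).
Qed.

Lemma differentiable_mxP {R : realType} {V : normedModType R} {m n}
    (f : V -> 'M[R]_(m, n)) x :
  differentiable f x <-> forall i j, differentiable (fun y => f y i j) x.
Proof.
split=> [df i j|df].
  apply: (differentiable_comp (g := fun N : 'M[R]_(m, n) => N i j) df).
  exact: differentiable_coord.
have -> : f = \sum_(i < m) \sum_(j < n) (fun y => f y i j *: delta_mx i j).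
  apply/funext => y; rewrite {1}[f y]matrix_sum_delta.
  rewrite fct_sumE; apply: eq_bigr => i _; rewrite fct_sumE.
  by apply: eq_bigr.
apply: differentiable_sum => i; apply: differentiable_sum => j.
exact: differentiableZl.
Qed.

Lemma derive_mxE {R : realType} {V : normedModType R} {m n}
    (f : V -> 'M[R]_(m, n)) x v i j :
  differentiable f x -> ('D_v f x) i j = 'D_v (fun y => f y i j) x.
Proof.
by move=> /diff_derivable => /(_ v) /derive_mx ->; rewrite mxE.
Qed.

Lemma derive_compE {R : realType} {U V W : normedModType R}
    (f : U -> V) (g : V -> W) x y v : f x = y ->
  differentiable f x -> differentiable g y ->
  'D_v (fun z => g (f z)) x = 'D_('D_v f x) g y.
Proof.
move=> <- df dg; rewrite (deriveE _ df) (deriveE _ dg) deriveE.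
  by rewrite (diff_comp df dg).
exact: differentiable_comp df dg.
Qed.

Lemma deriveE_col {R : realType} {d} {W : normedModType R}
    (g : 'cV[R]_d -> W) x v : differentiable g x ->
  'D_v g x = \sum_(j < d) v j 0 *: 'D_(delta_mx j 0) g x.
Proof.
move=> dg; rewrite deriveE // {1}[v]matrix_sum_delta linear_sum.
apply: eq_bigr => j _; rewrite big_ord1 linearZ /=.
by rewrite deriveE.
Qed.

Lemma derive_mulE {R : realType} {V : normedModType R} (f g : V -> R) x v :
  differentiable f x -> differentiable g x ->
  'D_v (fun y => f y * g y) x = 'D_v f x * g x + f x * 'D_v g x.
Proof.
move=> /diff_derivable df /diff_derivable dg.
by rewrite (@deriveM _ _ f g) // addrC /GRing.scale /= [g x * _]mulrC.
Qed.

Lemma mulmx_entry_fct {R : realType} {V : normedModType R} {m n p}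
    (f : V -> 'M[R]_(m, n)) (g : V -> 'M[R]_(n, p)) i j :
  (fun y => (f y *m g y) i j) = \sum_l (fun y => f y i l * g y l j).
Proof. by apply/funext => y; rewrite mxE fct_sumE. Qed.

Lemma differentiable_mulmx {R : realType} {V : normedModType R} {m n p}
    (f : V -> 'M[R]_(m, n)) (g : V -> 'M[R]_(n, p)) x :
  differentiable f x -> differentiable g x ->
  differentiable (fun y => f y *m g y) x.
Proof.
move=> /differentiable_mxP df /differentiable_mxP dg.
apply/differentiable_mxP => i j; rewrite mulmx_entry_fct.
by apply: differentiable_sum => l; apply: differentiableM.
Qed.

Lemma derive_mulmx {R : realType} {V : normedModType R} {m n p}
    (f : V -> 'M[R]_(m, n)) (g : V -> 'M[R]_(n, p)) x v :
  differentiable f x -> differentiable g x ->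
  'D_v (fun y => f y *m g y) x = 'D_v f x *m g x + f x *m 'D_v g x.
Proof.
move=> df dg; have /differentiable_mxP df' := df.
have /differentiable_mxP dg' := dg.
apply/matrixP => i j; rewrite (derive_mxE v i j (differentiable_mulmx df dg)).
rewrite mulmx_entry_fct derive_sum; last first.
  by move=> l; apply/diff_derivable/differentiableM.
rewrite !mxE -big_split; apply: eq_bigr => l _ /=.
by rewrite derive_mulE // !derive_mxE.
Qed.

Lemma differentiable_scalemx {R : realType} {V : normedModType R} {m n}
    (a : V -> R) (f : V -> 'M[R]_(m, n)) x :
  differentiable a x -> differentiable f x ->
  differentiable (fun y => a y *: f y) x.
Proof.
move=> da /differentiable_mxP df; apply/differentiable_mxP => i j.
rewrite (_ : (fun y => _) = (fun y => a y * f y i j)).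
  exact: differentiableM.
by apply/funext => y; rewrite mxE.
Qed.

Lemma derive_scalemx {R : realType} {V : normedModType R} {m n}
    (a : V -> R) (f : V -> 'M[R]_(m, n)) x v :
  differentiable a x -> differentiable f x ->
  'D_v (fun y => a y *: f y) x = 'D_v a x *: f x + a x *: 'D_v f x.
Proof.
move=> da df; have /differentiable_mxP df' := df.
apply/matrixP => i j; rewrite (derive_mxE v i j (differentiable_scalemx da df)).
rewrite (_ : (fun y => _) = (fun y => a y * f y i j)).
  by rewrite derive_mulE // !mxE derive_mxE.
by apply/funext => y; rewrite mxE.
Qed.

Lemma differentiable_mxtrace {R : realType} {V : normedModType R} {n}
    (f : V -> 'M[R]_n) x :
  differentiable f x -> differentiable (fun y => \tr (f y)) x.
Proof.
move=> /differentiable_mxP df.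
rewrite (_ : (fun y => _) = \sum_i (fun y => f y i i)).
  exact: differentiable_sum.
by apply/funext => y; rewrite fct_sumE.
Qed.

Lemma derive_realE {R : realType} (f : R -> R) x v : differentiable f x ->
  'D_v f x = v * 'D_1 f x.
Proof.
move=> df; rewrite !(deriveE _ df) -[in LHS](mulr1 v).
by rewrite -[v * 1]/(v *: 1) linearZ.
Qed.

(** * Closure properties of maps of class C^k on an open set *)

Section CkCalculus.
Context {R : realType} {V : normedModType R}.
Implicit Types (U : set V) (k : nat).

Lemma near_eq_on {W : Type} U (f g : V -> W) x : open U -> U x ->
  (forall y, U y -> f y = g y) -> {near x, f =1 g}.
Proof. by move=> oU Ux fg; apply: filterS fg _; apply: open_nbhs_nbhs. Qed.

(** As [U] is open, agreement on [U] is agreement near each of its points, so it passes to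
    directional derivatives. *)
Lemma Ck_ext {W : normedModType R} k U (f g : V -> W) : open U ->
  (forall x, U x -> f x = g x) -> Ck k U f -> Ck k U g.
Proof.
move=> oU; elim: k f g => [|k IH] f g fg /=.
  move=> cf x Ux; rewrite /prop_for /continuous_at -(fg x Ux).
  apply: cvg_trans (cf x Ux); apply: near_eq_cvg.
  exact: near_eq_on fg.
case=> df Df; split=> [x Ux|v].
  by apply: near_eq_differentiable (df x Ux); apply: near_eq_on fg.
apply: IH (Df v) => x Ux; apply: near_eq_derive.
exact: near_eq_on fg.
Qed.

Lemma Ck_sub {W : normedModType R} k U U' (f : V -> W) :
  U' `<=` U -> Ck k U f -> Ck k U' f.
Proof.
move=> sU; elim: k f => [|k IH] f /=; first by move=> cf x /sU /cf.
by case=> df Df; split=> [x /sU /df|v] //; apply: IH.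
Qed.

Lemma Ck_pred {W : normedModType R} k U (f : V -> W) :
  Ck k.+1 U f -> Ck k U f.
Proof.
elim: k f => [|k IH] f [df Df].
  by move=> x Ux; apply/differentiable_continuous/df.
by split=> // v; apply: IH.
Qed.

Lemma Ck_cst {W : normedModType R} k U (c : W) : Ck k U (fun _ => c).
Proof.
elim: k c => [|k IH] c /=; first by move=> x _; apply: cst_continuous.
split=> [x _|v]; first exact: differentiable_cst.
have -> : (fun x => 'D_v (fun _ : V => c) x) = (fun _ => 0).
  by apply/funext => x; apply: derive_cst.
exact: IH.
Qed.

(** Sums and products are treated for real-valued functions; this lemma and [Ck_coord] carry them
    over to matrices entry by entry. *)
Lemma Ck_mx k U m n (f : V -> 'M[R]_(m, n)) : open U ->
  (forall i j, Ck k U (fun x => f x i j)) -> Ck k U f.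
Proof.
move=> oU; elim: k f => [|k IH] f cf.
  move=> x Ux; apply/cvg_ballP => e e0.
  have H : \forall y \near x, forall i j, ball (f x i j) e (f y i j).
    apply: filter_forall => i; apply: filter_forall => j.
    exact: (cvg_ballP _ _).1 (cf i j x Ux) e e0.
  apply: filterS H => y Hy; split => // i j; apply: Hy.
have df x : U x -> differentiable f x.
  by move=> Ux; apply/differentiable_mxP => i j; apply: (cf i j).1.
split=> // v; apply: IH => i j; apply: Ck_ext ((cf i j).2 v) => // x Ux.
by rewrite derive_mxE //; apply: df.
Qed.

Lemma Ck_coord k U m n (f : V -> 'M[R]_(m, n)) i j : open U ->
  Ck k U f -> Ck k U (fun x => f x i j).
Proof.
move=> oU; elim: k f => [|k IH] f.
  move=> cf x Ux.
  apply: (continuous_comp (g := fun N : 'M[R]_(m, n) => N i j) (cf x Ux)).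
  exact: coord_continuous.
case=> df Df; split=> [x Ux|v]; first by apply/(differentiable_mxP _ _).1/df.
apply: Ck_ext (IH _ (Df v)) => // x Ux.
by rewrite derive_mxE //; apply: df.
Qed.

Lemma Ck_add k U (f g : V -> R) : open U ->
  Ck k U f -> Ck k U g -> Ck k U (fun x => f x + g x).
Proof.
move=> oU; elim: k f g => [|k IH] f g.
  by move=> cf cg x Ux; apply: cvgD; [apply: cf|apply: cg].
move=> [df Df] [dg Dg]; split=> [x Ux|v].
  by apply: differentiableD; [apply: df|apply: dg].
apply: Ck_ext (IH _ _ (Df v) (Dg v)) => // x Ux.
by rewrite (@deriveD _ _ _ f g) //; apply: diff_derivable;
  [apply: df|apply: dg].
Qed.

Lemma Ck_mul k U (f g : V -> R) : open U ->
  Ck k U f -> Ck k U g -> Ck k U (fun x => f x * g x).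
Proof.
move=> oU; elim: k f g => [|k IH] f g.
  by move=> cf cg x Ux; apply: cvgM; [apply: cf|apply: cg].
move=> cf cg; have [df Df] := cf; have [dg Dg] := cg; split=> [x Ux|v].
  by apply: differentiableM; [apply: df|apply: dg].
(* Each term of the Leibniz rule keeps one factor underived, whose class is lowered to [k] to match
   the derived one. *)
have cf' := Ck_pred cf; have cg' := Ck_pred cg.
apply: Ck_ext (Ck_add oU (IH _ _ (Df v) cg') (IH _ _ cf' (Dg v))) => // x Ux.
by rewrite derive_mulE //; [apply: df|apply: dg].
Qed.

Lemma Ck_sum k U I (r : seq I) (f : I -> V -> R) : open U ->
  (forall i, Ck k U (f i)) -> Ck k U (fun x => \sum_(i <- r) f i x).
Proof.
move=> oU cf; elim: r => [|i r IH].
  by apply: (Ck_ext oU _ (Ck_cst k U (0 : R))) => x _; rewrite big_nil.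
by apply: Ck_ext (Ck_add oU (cf i) IH) => // x _; rewrite big_cons.
Qed.

Lemma Ck_mulmx k U m n p (f : V -> 'M[R]_(m, n)) (g : V -> 'M[R]_(n, p)) :
  open U -> Ck k U f -> Ck k U g -> Ck k U (fun x => f x *m g x).
Proof.
move=> oU cf cg; apply: Ck_mx => // i j.
have H l : Ck k U (fun x => f x i l * g x l j).
  by apply: Ck_mul => //; apply: Ck_coord.
apply: Ck_ext (Ck_sum (index_enum _) oU H) => // x _.
by rewrite mxE.
Qed.

Lemma Ck_addmx k U m n (f g : V -> 'M[R]_(m, n)) : open U ->
  Ck k U f -> Ck k U g -> Ck k U (fun x => f x + g x).
Proof.
move=> oU cf cg; apply: Ck_mx => // i j.
have H := Ck_add oU (Ck_coord i j oU cf) (Ck_coord i j oU cg).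
by apply: Ck_ext H => // x _; rewrite mxE.
Qed.

Lemma Ck_scalemx k U m n (a : V -> R) (f : V -> 'M[R]_(m, n)) : open U ->
  Ck k U a -> Ck k U f -> Ck k U (fun x => a x *: f x).
Proof.
move=> oU ca cf; apply: Ck_mx => // i j.
have H := Ck_mul oU ca (Ck_coord i j oU cf).
by apply: Ck_ext H => // x _; rewrite mxE.
Qed.

(** By the chain rule the derivative of the composite is a sum of products of a coordinate of
    ['D_v f] with a partial derivative of [g] taken along [f]. The induction is applied to these
    partial derivatives, with [f] fixed. *)
Lemma Ck_comp k d U (U' : set 'cV[R]_d) (f : V -> 'cV[R]_d)
    (g : 'cV[R]_d -> R) : open U ->
  (forall x, U x -> U' (f x)) -> Ck k U f -> Ck k U' g ->
  Ck k U (fun x => g (f x)).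
Proof.
move=> oU fU; elim: k g => [|k IH] g.
  move=> cf cg x Ux; apply: (continuous_comp (cf x Ux)).
  exact/cg/fU.
move=> cf [dg Dg]; have [df Df] := cf.
have df' x : U x -> differentiable g (f x) by move=> /fU /dg.
split=> [x Ux|v].
  by apply: differentiable_comp; [apply: df|apply: df'].
have H j : Ck k U (fun x => ('D_v f x) j 0 * 'D_(delta_mx j 0) g (f x)).
  apply: Ck_mul => //; first exact: Ck_coord (Df v).
  by apply: IH (Dg _); apply: Ck_pred.
apply: Ck_ext (Ck_sum (index_enum _) oU H) => // x Ux.
rewrite (derive_compE _ erefl (df x Ux) (df' x Ux)).
by rewrite (deriveE_col _ (df' x Ux)).
Qed.

End CkCalculus.

(** * Smoothness of the trigonometric and exponential functions *)

Section CkElementary.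
Context {R : realType}.
Implicit Types (x r v : R) (U : set R).

Lemma is_derive_scaled (f : R -> R) (df : R) x r :
  is_derive (x * r) 1 f df -> is_derive r 1 (fun s => f (x * s)) (x * df).
Proof.
move=> dF; have dm : is_derive r 1 (fun s : R => x * s) x.
  by apply: is_derive_eq; rewrite /GRing.scale /= mulr1.
by have := @is_derive1_comp R f (fun s => x * s) r _ _ dF dm; rewrite mulrC.
Qed.

Lemma Ck_of_derive k U (f g : R -> R) : open U ->
  (forall r, is_derive r 1 f (g r)) -> Ck k U g -> Ck k.+1 U f.
Proof.
move=> oU fg cg; have df r : differentiable f r.
  by apply/derivable1_diffP; apply: ex_derive.
split=> [r _|v]; first exact: df.
apply: Ck_ext (Ck_mul oU (Ck_cst k U v) cg) => // r _.
by rewrite derive_realE // derive_val.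
Qed.

(** Each derivative is a multiple of the other function, whence the joint induction. *)
Lemma Ck_trig k U x : open U ->
  Ck k U (fun r : R => cos (x * r)) /\ Ck k U (fun r : R => sin (x * r)).
Proof.
move=> oU; elim: k => [|k [cc cs]].
  by split=> r _; apply/differentiable_continuous/derivable1_diffP;
    apply: ex_derive; apply: is_derive_scaled.
split.
  apply: (Ck_of_derive oU (fun r => is_derive_scaled (is_derive_cos (x * r)))).
  apply: Ck_ext (Ck_mul oU (Ck_cst k U (- x)) cs) => // r _.
  by rewrite mulrN mulNr.
apply: (Ck_of_derive oU (fun r => is_derive_scaled (is_derive_sin (x * r)))).
exact: Ck_mul (Ck_cst k U x) cc.
Qed.

Lemma Ck_expR k U x : open U -> Ck k U (fun r : R => expR (x * r)).
Proof.
move=> oU; elim: k => [|k IH].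
  by move=> r _; apply/differentiable_continuous/derivable1_diffP;
    apply: ex_derive; apply: is_derive_scaled.
apply: (Ck_of_derive oU (fun r => is_derive_scaled (is_derive_expR (x * r)))).
exact: Ck_mul (Ck_cst k U x) IH.
Qed.

End CkElementary.

(** * Charts and changes of coordinates *)

Section ChangeOfCharts.
Context {R : realType} {d : nat} {M : manifold R d}.
Implicit Types (x y p q : M) (U : set M).

Lemma chart_image_open x U : open U -> open (chart x @` (U `&` cdom x)).
Proof.
move=> oU; rewrite openE => _ [q [Uq xq] <-].
have Oq : (chart x @` cdom x) (chart x q) by exists q.
have cont := chart_inv_continuous Oq.
have nO : nbhs (chart x q) (chart x @` cdom x).
  by apply: open_nbhs_nbhs; split=> //; apply: chart_open.
have nU : nbhs (chart x q) (chart_inv x @^-1` U).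
  by apply: cont; rewrite (chartK xq); apply: open_nbhs_nbhs.
apply: filterS2 nO nU => w [r xr <-] /=; rewrite (chartK xr) => Ur.
by exists r.
Qed.

Lemma chart_overlap_open x y : open (chart x @` (cdom x `&` cdom y)).
Proof. by rewrite setIC; apply/chart_image_open/cdom_open. Qed.

Lemma transition_differentiable x y q : cdom x q -> cdom y q ->
  differentiable (fun z => chart y (chart_inv x z)) (chart x q).
Proof.
by move=> xq yq; apply: (chart_smooth x y 1).1; exists q.
Qed.

Lemma jac_mul x y q v : cdom x q -> cdom y q ->
  jac x y q *m v = 'D_v (fun z => chart y (chart_inv x z)) (chart x q).
Proof.
move=> xq yq; have dt := transition_differentiable xq yq.
rewrite (deriveE_col v dt); apply/colP => i; rewrite mxE summxE.
by apply: eq_bigr => j _; rewrite !mxE mulrC.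
Qed.

Lemma mulmx_col_inj m n (A B : 'M[R]_(m, n)) :
  (forall v : 'cV_n, A *m v = B *m v) -> A = B.
Proof.
move=> H; apply/matrixP => i j; have := H (delta_mx j 0).
by rewrite -!colE => /colP /(_ i); rewrite !mxE.
Qed.

Lemma near_overlap x y q (P : 'cV[R]_d -> Prop) : cdom x q -> cdom y q ->
  (forall r, cdom x r -> cdom y r -> P (chart x r)) ->
  \forall z \near chart x q, P z.
Proof.
move=> xq yq H.
have n : nbhs (chart x q) (chart x @` (cdom x `&` cdom y)).
  by apply: open_nbhs_nbhs; split; [exact: chart_overlap_open|exists q].
by apply: filterS n => _ [r [xr yr] <-]; apply: H.
Qed.

(** The chain rule for transition maps; composing through [y] gives the direct transition on the
    overlap of [cdom x] and [cdom y], a neighbourhood of the point. *)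
Lemma jac_trans x y z q : cdom x q -> cdom y q -> cdom z q ->
  jac y z q *m jac x y q = jac x z q.
Proof.
move=> xq yq zq; apply: mulmx_col_inj => v; rewrite -mulmxA.
apply: etrans (jac_mul (jac x y q *m v) yq zq) _.
apply: etrans _ (esym (jac_mul v xq zq)); rewrite (jac_mul v xq yq).
have dxy := transition_differentiable xq yq.
have dyz := transition_differentiable yq zq.
have cq : chart y (chart_inv x (chart x q)) = chart y q by rewrite chartK.
apply: etrans (esym (derive_compE v cq dxy dyz)) _.
apply: near_eq_derive; apply: (near_overlap xq yq) => r xr yr.
by rewrite !chartK.
Qed.

Lemma jac_id x q : cdom x q -> jac x x q = 1%:M.
Proof.
move=> xq; apply: mulmx_col_inj => v; rewrite jac_mul // mul1mx.
rewrite -[RHS](derive_id (chart x q) v); apply: near_eq_derive.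
by apply: (near_overlap xq xq) => r xr _; rewrite chartK.
Qed.

Lemma jacK p q : cdom p q -> jac p q q *m jac q p q = 1%:M.
Proof.
by move=> pq; rewrite jac_trans ?jac_id //; apply: cdom_refl.
Qed.

Lemma jacKV p q : cdom p q -> jac q p q *m jac p q q = 1%:M.
Proof.
by move=> pq; rewrite jac_trans ?jac_id //; apply: cdom_refl.
Qed.

(** The coordinate fields of the chart around [p], from which [christoffel] is built. Vectors at [q]
    are expressed in the chart of [q] itself, hence the Jacobian. *)
Definition coord_vf p (j : 'I_d) (q : M) : 'cV[R]_d := col j (jac p q q).

(** Read in the chart of [x], this field is a partial derivative of the transition from [p] to [x],
    precomposed with the transition from [x] to [p]. *)
Lemma coord_vf_smooth p j : smooth_vf (cdom p) (coord_vf p j).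
Proof.
move=> x k; set A := chart x @` _.
have oA : open A by rewrite /A; apply/chart_image_open/cdom_open.
pose g w := 'D_(delta_mx j 0) (fun z => chart x (chart_inv p z)) w.
have cg : Ck k (chart p @` (cdom p `&` cdom x)) g.
  by have [_ /(_ (delta_mx j 0))] := chart_smooth p x k.+1.
have ct : Ck k A (fun z => chart p (chart_inv x z)).
  by have := chart_smooth x p k; rewrite /A setIC.
have tA z : A z -> (chart p @` (cdom p `&` cdom x)) (chart p (chart_inv x z)).
  by move=> [r [pr xr] <-]; rewrite (chartK xr); exists r.
have H : Ck k A (fun z => g (chart p (chart_inv x z))).
  apply: Ck_mx => // i l.
  have cgi := Ck_coord i l (@chart_overlap_open p x) cg.
  exact: Ck_comp oA tA ct cgi.
apply: Ck_ext H => // _ [r [pr xr] <-].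
rewrite /vf_in /coord_vf (chartK xr) colE mulmxA.
rewrite jac_trans //; last exact: cdom_refl.
by rewrite jac_mul.
Qed.

Lemma end_in_coord_smooth p U A i j : open U -> smooth_end U A ->
  smooth_fun (U `&` cdom p) (fun q => end_in p A (chart p q) i j).
Proof.
move=> oU sA x k; set B := chart x @` _.
have oB : open B.
  by apply/chart_image_open/openI => //; apply: cdom_open.
have ct : Ck k B (fun z => chart p (chart_inv x z)).
  by apply: Ck_sub (chart_smooth x p k) => _ [r [[Ur pr] xr] <-]; exists r.
have tB z : B z -> (chart p @` (U `&` cdom p)) (chart p (chart_inv x z)).
  by move=> [r [[Ur pr] xr] <-]; rewrite (chartK xr); exists r.
have cA := Ck_coord i j (@chart_image_open p _ oU) (sA p k).
exact: Ck_comp oB tB ct cA.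
Qed.

Lemma smooth_vf_add U Y Z : open U -> smooth_vf U Y -> smooth_vf U Z ->
  smooth_vf U (fun q => Y q + Z q).
Proof.
move=> oU sY sZ x k; have oA := @chart_image_open x _ oU.
apply: Ck_ext (Ck_addmx oA (sY x k) (sZ x k)) => // w _.
by rewrite /vf_in mulmxDr.
Qed.

Lemma smooth_vf_scale U f Y : open U -> smooth_fun U f -> smooth_vf U Y ->
  smooth_vf U (fun q => f q *: Y q).
Proof.
move=> oU sf sY x k; have oA := @chart_image_open x _ oU.
apply: Ck_ext (Ck_scalemx oA (sf x k) (sY x k)) => // w _.
by rewrite /vf_in -scalemxAr.
Qed.

Lemma smooth_vf0 U : smooth_vf U (fun _ => 0).
Proof.
move=> x k; rewrite (_ : vf_in _ _ = fun=> 0); first exact: Ck_cst.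
by apply/funext => z; rewrite /vf_in mulmx0.
Qed.

Lemma smooth_vf_sum U I (r : seq I) (Y : I -> M -> 'cV[R]_d) : open U ->
  (forall i, smooth_vf U (Y i)) -> smooth_vf U (fun q => \sum_(i <- r) Y i q).
Proof.
move=> oU sY; elim: r => [|i r IH].
  rewrite (_ : (fun q => _) = fun=> 0); first exact: smooth_vf0.
  by apply/funext => q; rewrite big_nil.
rewrite (_ : (fun q => _) = fun q => Y i q + \sum_(i <- r) Y i q).
  exact: smooth_vf_add.
by apply/funext => q; rewrite big_cons.
Qed.

Lemma smooth_vf_sub U U' Y : U' `<=` U -> smooth_vf U Y -> smooth_vf U' Y.
Proof.
move=> sU sY x k; apply: Ck_sub (sY x k).
by apply: image_subset; apply: setSI.
Qed.

End ChangeOfCharts.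

(** * Connections *)

Lemma sum_scale_col {R : realType} m n p
    (A : 'M[R]_(m, n)) (B : 'M[R]_(n, p)) j :
  \sum_i B i j *: col i A = A *m col j B.
Proof.
apply/colP => l; rewrite summxE !mxE.
by apply: eq_bigr => i _; rewrite !mxE mulrC.
Qed.

Section Connections.
Context {R : realType} {d : nat} {M : manifold R d}.
Context (nabla : connection_op M) (conn : is_connection nabla).
Implicit Types (p q : M) (U : set M) (Y Z : M -> 'cV[R]_d) (v : 'cV[R]_d).

Lemma smooth_vf_ext U Y Z : open U -> (forall q, U q -> Y q = Z q) ->
  smooth_vf U Y -> smooth_vf U Z.
Proof.
move=> oU YZ sY x k; apply: Ck_ext (sY x k); first exact: chart_image_open.
by move=> _ [q [Uq xq] <-]; rewrite /vf_in (chartK xq) YZ.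
Qed.

(* Multiplying by the indicator function of [U] and applying the Leibniz rule
   turns fields that agree on [U] into equal fields. *)
Lemma nabla_local U p v Y Z : open U -> U p -> smooth_vf U Y ->
  (forall q, U q -> Y q = Z q) -> nabla p v Y = nabla p v Z.
Proof.
move=> oU Up sY YZ; have sZ := smooth_vf_ext oU YZ sY.
pose f : M -> R := \1_U.
have f1 q : U q -> f q = 1 by move=> Uq; rewrite /f indicE mem_set.
have sf : smooth_fun U f.
  move=> x k; have oA := @chart_image_open _ _ _ x _ oU.
  apply: (Ck_ext oA _ (Ck_cst k _ (1 : R))) => _ [q [Uq xq] <-].
  by rewrite /fun_in (chartK xq) f1.
have df : dfun p v f = 0.
  rewrite /dfun -[RHS](derive_cst (1 : R) (chart p p) v).
  apply: near_eq_derive; have oA := @chart_image_open _ _ _ p _ oU.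
  apply: (near_eq_on oA).
    by exists p => //; split=> //; apply: cdom_refl.
  by move=> _ [q [Uq xq] <-]; rewrite /fun_in (chartK xq) f1.
have E W : smooth_vf U W -> nabla p v (fun q => f q *: W q) = nabla p v W.
  move=> /(nabla_leibniz conn v oU Up sf) ->.
  by rewrite df f1 // scale0r add0r scale1r.
rewrite -(E Y sY) -(E Z sZ); congr (nabla p v _); apply/funext => q.
have [Uq|nUq] := pselect (U q); first by rewrite YZ.
by rewrite /f indicE memNset // !scale0r.
Qed.

Lemma nabla_sum U p v I (r : seq I) (Y : I -> M -> 'cV[R]_d) :
  open U -> U p -> (forall i, smooth_vf U (Y i)) ->
  nabla p v (fun q => \sum_(i <- r) Y i q) = \sum_(i <- r) nabla p v (Y i).
Proof.
move=> oU Up sY; elim: r => [|i r IH].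
  rewrite big_nil (_ : (fun q => _) = fun=> 0); last first.
    by apply/funext => q; rewrite big_nil.
  have s0 : smooth_vf U (fun _ : M => 0 : 'cV[R]_d) by apply: smooth_vf0.
  (* Additivity for [0 + 0] forces the derivative of the zero field to vanish. *)
  have := nabla_add conn v oU Up s0 s0; rewrite addr0 => /eqP.
  by rewrite -subr_eq0 opprD addrA subrr sub0r oppr_eq0 => /eqP.
rewrite big_cons -IH -(nabla_add conn v oU Up (sY i)); last first.
  exact: smooth_vf_sum.
by congr (nabla p v _); apply/funext => q; rewrite big_cons.
Qed.

Lemma christoffelP p a v w :
  christoffel nabla p (a *: v + w) =
  a *: christoffel nabla p v + christoffel nabla p w.
Proof.
apply/matrixP => i j; rewrite !mxE.
have := nabla_linear conn a v w (@cdom_open _ _ M p) (cdom_refl p)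
  (@coord_vf_smooth _ _ _ p j).
by rewrite /coord_vf => ->; rewrite !mxE.
Qed.

Lemma christoffel0 p : christoffel nabla p 0 = 0.
Proof.
have := christoffelP p (- 1) 0 0.
by rewrite scaler0 addr0 scaleN1r addNr.
Qed.

Lemma col_christoffel p v j :
  col j (christoffel nabla p v) = nabla p v (coord_vf p j).
Proof. by apply/colP => i; rewrite !mxE. Qed.

Lemma end_in_at p A : end_in p A (chart p p) = A p.
Proof.
rewrite /end_in (chartK (cdom_refl p)) jac_id ?mul1mx ?mulmx1 //.
exact: cdom_refl.
Qed.

Lemma end_in_differentiable U p A : open U -> U p -> smooth_end U A ->
  differentiable (end_in p A) (chart p p).
Proof.
move=> oU Up sA; apply: (sA p 1).1.
by exists p => //; split=> //; apply: cdom_refl.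
Qed.

(** The identity [is_nabla_end] is tested on coordinate fields: [A] sends each of them to a
    combination of all of them with entries of [end_in p A] as coefficients, and the Leibniz rule
    applies. This turns the hypothesis [preserves] into the matrix expression that occurs in
    [cov_frame]. *)
Lemma nabla_endE U p v A B : open U -> U p -> smooth_end U A ->
  is_nabla_end nabla p v A B ->
  B = 'D_v (end_in p A) (chart p p)
      + christoffel nabla p v *m A p - A p *m christoffel nabla p v.
Proof.
move=> oU Up sA dA; pose U' := U `&` cdom p.
have oU' : open U' by apply: openI => //; apply: cdom_open.
have Up' : U' p by split=> //; apply: cdom_refl.
have sV j : smooth_vf U' (coord_vf p j).
  by apply: smooth_vf_sub (@coord_vf_smooth _ _ _ p j); apply: subIsetr.
pose f i j q := end_in p A (chart p q) i j.
have sf i j : smooth_fun U' (f i j) by apply: end_in_coord_smooth.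
have sfV i j : smooth_vf U' (fun q => f i j q *: coord_vf p i q).
  exact: smooth_vf_scale.
have dE := end_in_differentiable oU Up sA.
have AV j q : U' q -> \sum_i f i j q *: coord_vf p i q = A q *m coord_vf p j q.
  move=> [Uq pq].
  have E : A q *m jac p q q = jac p q q *m end_in p A (chart p q).
    by rewrite /end_in (chartK pq) !mulmxA jacK // mul1mx.
  rewrite /coord_vf [in RHS]colE mulmxA E -mulmxA -colE.
  exact: sum_scale_col.
have nAV j : nabla p v (fun q => A q *m coord_vf p j q) =
    col j ('D_v (end_in p A) (chart p p) + christoffel nabla p v *m A p).
  rewrite -(nabla_local v oU' Up' _ (AV j)); last exact: smooth_vf_sum.
  rewrite (nabla_sum v _ oU' Up' (fun i => sfV i j)).
  rewrite (eq_bigr (fun i => ('D_v (end_in p A) (chart p p)) i j *: col i 1%:M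
      + A p i j *: col i (christoffel nabla p v))).
    by rewrite big_split /= !sum_scale_col mul1mx linearD /= [col j (_ *m _)]colE
         -mulmxA -colE.
  move=> i _; rewrite (nabla_leibniz conn v oU' Up' (sf i j) (sV i)).
  rewrite col_christoffel {2}/f end_in_at /coord_vf jac_id; last exact: cdom_refl.
  suff -> : dfun p v (f i j) = ('D_v (end_in p A) (chart p p)) i j by [].
  apply: etrans _ (esym (derive_mxE v i j dE)); apply: near_eq_derive.
  have pp := cdom_refl p; apply: (near_overlap pp pp) => r pr _.
  by rewrite /fun_in (chartK pr).
(* At [p] the coordinate fields form the standard basis, so the identity for the [j]-th field is the
   [j]-th column of the claim. *)
apply/matrixP => i j.
have /colP /(_ i) := dA U' (coord_vf p j) oU' Up' (sV j).
rewrite nAV /coord_vf jac_id; last exact: cdom_refl.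
by rewrite -col_christoffel !colE mul1mx mulmxA -!colE !mxE => <-.
Qed.

End Connections.

(** * Quaternionic frames *)

Lemma ord3P (P : 'I_3 -> Prop) : P 0 -> P 1 -> P 2 -> forall a, P a.
Proof.
move=> P0 P1 P2 a; have [H|H|H] : [\/ a = 0, a = 1 | a = 2]; last first.
- by rewrite H.
- by rewrite H.
- by rewrite H.
case: a => [[|[|[|//]]] lt]; [apply: Or31|apply: Or32|apply: Or33];
  exact: val_inj.
Qed.

Lemma add3E :
  ((1 + 1 = 2 :> 'I_3)%R * (1 + 2 = 0 :> 'I_3)%R * (2 + 1 = 0 :> 'I_3)%R *
   (2 + 2 = 1 :> 'I_3)%R * (0 + 1 = 1 :> 'I_3)%R * (0 + 2 = 2 :> 'I_3)%R)%type.
Proof. by do !split; apply: val_inj. Qed.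

Lemma sum3E {V : nmodType} (F : 'I_3 -> V) : \sum_a F a = F 0 + F 1 + F 2.
Proof.
rewrite !big_ord_recl big_ord0 addr0 addrA.
by congr (F _ + F _ + F _); apply: val_inj.
Qed.

Lemma sum3_cyclic {V : nmodType} (F : 'I_3 -> V) a :
  \sum_b F b = F a + F (a + 1) + F (a + 2).
Proof.
rewrite sum3E; move: a; apply: ord3P; rewrite !add3E //.
  by rewrite [RHS]addrC addrA.
by rewrite [LHS]addrC addrA.
Qed.

Section QuaternionFrames.
Context {R : realType} {d : nat}.
Implicit Types (I J C : 'I_3 -> 'M[R]_d).

Lemma quaternion_relP I : quaternion_rel I ->
  forall a, [/\ I a *m I a = - 1%:M, I a *m I (a + 1) = I (a + 2) &
                I (a + 1) *m I a = - I (a + 2)].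
Proof.
move=> [sq I012].
have cancelr a (A : 'M[R]_d) : A *m I a *m I a = - A.
  by rewrite -mulmxA sq mulmxN mulmx1.
have cancell a (A : 'M[R]_d) : I a *m (I a *m A) = - A.
  by rewrite mulmxA sq mulNmx mul1mx.
have I01 : I 0 *m I 1 = I 2.
  by have := cancelr 2 (I 0 *m I 1); rewrite I012 mulNmx mul1mx => /oppr_inj.
have I20 : I 2 *m I 0 = I 1.
  have := cancelr 1 (I 2 *m I 0).
  by rewrite -(mulmxA (I 2) (I 0)) I01 sq mulNmx mul1mx => /oppr_inj.
have I10 : I 1 *m I 0 = - I 2.
  have := cancell 0 (I 1 *m I 0); rewrite (mulmxA (I 0) (I 1)) I01 I20 I01.
  by move=> ->; rewrite opprK.
have I12 : I 1 *m I 2 = I 0.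
  by rewrite -I01 mulmxA I10 mulNmx -I01 cancelr opprK.
have I21 : I 2 *m I 1 = - I 0 by rewrite -I01 cancelr.
have I02 : I 0 *m I 2 = - I 1 by rewrite -I01 cancell.
by apply: ord3P; rewrite !add3E.
Qed.

Context (d_gt0 : (0 < d)%N).

(** The trace of a product is symmetric, whereas distinct units anticommute, so a frame is
    orthogonal for the trace form. *)
Lemma quaternion_tr I : quaternion_rel I ->
  forall a b, \tr (I a *m I b) = - d%:R * (a == b)%:R.
Proof.
move=> qI.
have off a : \tr (I a *m I (a + 1)) = 0.
  have [_ e1 e2] := quaternion_relP qI a.
  have := mxtrace_mulC (I a) (I (a + 1)); rewrite e1 e2 raddfN /= => /eqP.
  by rewrite -addr_eq0 -mulr2n mulrn_eq0 /= => /eqP.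
have off' a : \tr (I (a + 1) *m I a) = 0 by rewrite mxtrace_mulC.
have diag a : \tr (I a *m I a) = - d%:R.
  by rewrite qI.1 raddfN /= mxtrace1.
have o0 := off 0; have o1 := off 1; have o2 := off 2.
have o0' := off' 0; have o1' := off' 1; have o2' := off' 2.
rewrite !add3E in o0 o1 o2 o0' o1' o2'.
by apply: ord3P; apply: ord3P; rewrite ?diag ?mulr1 ?mulr0.
Qed.

Lemma natd_neq0 : d%:R != 0 :> R.
Proof. by rewrite pnatr_eq0 -lt0n. Qed.

Lemma quaternion_coord I x b : quaternion_rel I ->
  \tr ((\sum_a x a *: I a) *m I b) = - d%:R * x b.
Proof.
move=> qI; rewrite mulmx_suml raddf_sum (bigD1 b) //= big1 ?addr0.
  by rewrite -scalemxAl linearZ /= quaternion_tr // eqxx mulr1 mulrC.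
move=> a /negbTE ab; rewrite -scalemxAl linearZ /= quaternion_tr // ab.
by rewrite !mulr0.
Qed.

Definition qspan I : set 'M[R]_d :=
  [set A | exists x : 'I_3 -> R, A = \sum_a x a *: I a].

(** Orthogonality gives the coefficients as explicit traces, which are therefore differentiable when
    [A] and [I] vary differentiably. *)
Lemma qspan_proj I A : quaternion_rel I -> qspan I A ->
  A = \sum_b (- d%:R^-1 * \tr (A *m I b)) *: I b.
Proof.
move=> qI [x ->]; apply: eq_bigr => b _; rewrite quaternion_coord //.
by rewrite mulrA mulrNN mulVf ?mul1r // natd_neq0.
Qed.

Lemma qspanD I A B (a : R) : qspan I A -> qspan I B -> qspan I (a *: A + B).
Proof.
move=> [x ->] [y ->]; exists (fun b => a * x b + y b).
rewrite scaler_sumr -big_split; apply: eq_bigr => b _ /=.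
by rewrite scalerDl scalerA.
Qed.

Lemma qspan0 I : qspan I 0.
Proof.
by exists (fun=> 0); rewrite big1 // => b _; rewrite scale0r.
Qed.

Lemma qspan_gen I a : qspan I (I a).
Proof.
exists (fun b => (b == a)%:R); rewrite (bigD1 a) //= eqxx scale1r big1 ?addr0 //.
by move=> b /negbTE ->; rewrite scale0r.
Qed.

Lemma qspan_sum I (r : seq 'I_3) (x : 'I_3 -> R) (A : 'I_3 -> 'M[R]_d) :
  (forall b, qspan I (A b)) -> qspan I (\sum_(b <- r) x b *: A b).
Proof.
move=> sA; elim: r => [|b r IH]; first by rewrite big_nil; apply: qspan0.
by rewrite big_cons; apply: qspanD.
Qed.

(** Both frames are orthogonal for the trace form with the same norms, so the matrix from one to the
    other is orthogonal, hence invertible. *)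
Lemma qspan_frame I J : quaternion_rel I -> quaternion_rel J ->
  (forall a, qspan J (I a)) -> forall A, qspan J A -> qspan I A.
Proof.
move=> qI qJ IJ A [y ->]; apply: qspan_sum => b.
pose B : 'M[R]_3 := \matrix_(a, c) (- d%:R^-1 * \tr (I a *m J c)).
have IB a : I a = \sum_c B a c *: J c.
  by rewrite {1}(qspan_proj qJ (IJ a)); apply: eq_bigr => c _; rewrite mxE.
have BBt : B *m B^T = 1%:M.
  apply/matrixP => a c; rewrite !mxE.
  have := quaternion_tr qI c a; rewrite {1}IB mulmx_suml raddf_sum /=.
  move=> /(congr1 (fun z => - d%:R^-1 * z)).
  rewrite mulrA mulrNN mulVf ?natd_neq0 // mul1r eq_sym => <-.
  rewrite mulr_sumr; apply: eq_bigr => l _.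
  rewrite -scalemxAl linearZ /= mxtrace_mulC [B^T _ _]mxE [B a l]mxE.
  by rewrite mulrCA mulrC.
have BtB : B^T *m B = 1%:M by apply: mulmx1C.
(* The transpose of [B] is its inverse, so column [b] of [B] expresses [J b] in the frame [I]. *)
exists (fun a => B a b); under eq_bigr do rewrite IB scaler_sumr.
rewrite exchange_big (bigD1 b) //= [X in _ + X]big1 ?addr0.
  have /matrixP /(_ b b) := BtB; rewrite !mxE eqxx mulr1n => e.
  rewrite -[LHS]scale1r -e scaler_suml; apply: eq_bigr => a _.
  by rewrite [B^T b a]mxE scalerA.
move=> c /negbTE cb; have /matrixP /(_ b c) := BtB.
rewrite !mxE eq_sym cb mulr0n => e.
rewrite -[RHS](scale0r (J c)) -e scaler_suml; apply: eq_bigr => a _.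
by rewrite [B^T b a]mxE scalerA.
Qed.

(** The adjoint action of [sp(1)]: twice the cross product of [x] with the [a]-th basis vector. *)
Lemma commutator_sum I (x : 'I_3 -> R) a : quaternion_rel I ->
  \sum_b x b *: (I b *m I a - I a *m I b)
  = (2 * x (a + 2)) *: I (a + 1) - (2 * x (a + 1)) *: I (a + 2).
Proof.
move=> qI; rewrite (sum3_cyclic _ a) subrr scaler0 add0r.
have [_ e1 e2] := quaternion_relP qI a.
have [_ e3 e4] := quaternion_relP qI (a + 2).
have e : a + 2 + 1 = a by rewrite -addrA add3E addr0.
have e' : a + 2 + 2 = a + 1 by rewrite -addrA add3E.
rewrite e e' in e3 e4; rewrite e1 e2 e3 e4 opprK addrC.
rewrite -[in - _ - _]opprD -!mulr2n !scalerN -scalerMnr.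
by rewrite -[X in _ - X]scalerMnr !scalerMnl !mulr_natl.
Qed.

(** The centre of [sp(1)] is trivial; tracing against [I (a + 1)] isolates the coefficient
    [x (a + 2)]. *)
Lemma commutator_sum_eq0 I (x : 'I_3 -> R) : quaternion_rel I ->
  (forall a, \sum_b x b *: (I b *m I a - I a *m I b) = 0) -> forall a, x a = 0.
Proof.
move=> qI x0.
have ne b : (b + 2 == b + 1 :> 'I_3) = false by move: b; apply: ord3P.
have H a : x (a + 2) = 0.
  have := x0 a; rewrite commutator_sum // => e.
  have E : \tr (((2 * x (a + 2)) *: I (a + 1) - (2 * x (a + 1)) *: I (a + 2))
     *m I (a + 1)) = 0 by rewrite e mul0mx raddf0.
  move: E; rewrite mulmxBl -!scalemxAl raddfB /= !linearZ /= !quaternion_tr //.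
  rewrite eqxx ne mulr1 mulr0 oppr0 scaler0 addr0 => /eqP.
  by rewrite !mulf_eq0 oppr_eq0 (negbTE natd_neq0) pnatr_eq0 /= orbF => /eqP.
by move=> a; rewrite -(H (a + 1)) -addrA add3E addr0.
Qed.

(* The trace form is negative definite on [qspan I], so the derivative of the
   relations [I a I b + I b I a = - 2 delta_ab] says that the matrix of [C] in
   the basis [I] is antisymmetric. *)
Lemma frame_derivation I C : quaternion_rel I -> (forall a, qspan I (C a)) ->
  (forall a b, C a *m I b + I a *m C b + (C b *m I a + I b *m C a) = 0) ->
  exists x : {ffun 'I_3 -> R},
    forall a, C a = \sum_b x b *: (I b *m I a - I a *m I b).
Proof.
move=> qI sC dC.
pose B a b := - d%:R^-1 * \tr (C a *m I b).
have CB a : C a = \sum_b B a b *: I b by exact: qspan_proj (sC a).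
have Banti a b : B a b = - B b a.
  apply/eqP; rewrite -addr_eq0 /B -mulrDr mulf_eq0; apply/orP; right.
  have /(congr1 mxtrace) := dC a b.
  rewrite !raddfD raddf0 /= (mxtrace_mulC (I a)) (mxtrace_mulC (I b)).
  by rewrite [X in _ + X]addrC -mulr2n => /eqP; rewrite mulrn_eq0.
have Bdiag a : B a a = 0.
  by apply/eqP; have /eqP := Banti a a; rewrite -addr_eq0 -mulr2n mulrn_eq0.
(* By [commutator_sum], the coefficient of [I (a + 2)] in the image of [I (a + 1)] is [2 * x a]. *)
exists [ffun a => B (a + 1) (a + 2) / 2] => a; rewrite commutator_sum // !ffunE.
have -> : a + 2 + 1 = a by rewrite -addrA add3E addr0.
have -> : a + 2 + 2 = a + 1 by rewrite -addrA add3E.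
have -> : a + 1 + 1 = a + 2 by rewrite -addrA.
have -> : a + 1 + 2 = a by rewrite -addrA add3E addr0.
rewrite ![2 * _]mulrC !divfK ?pnatr_eq0 // -scaleNr -Banti.
by rewrite CB (sum3_cyclic _ a) Bdiag scale0r add0r.
Qed.

End QuaternionFrames.

(** * Rotations of quaternionic frames by unit quaternions *)

Section FrameRotation.
Context {R : realType} {d : nat}.
Implicit Types (I : 'I_3 -> 'M[R]_d) (A B K : 'M[R]_d).

(** The Clifford form of the relations: the right-hand side is constant, which suits differentiation
    along a curve of frames. *)
Lemma quaternion_anticomm I : quaternion_rel I ->
  forall a b, I a *m I b + I b *m I a = (- (2 * (a == b)%:R))%:M.
Proof.
move=> qI.
have [e0 f0 g0] := quaternion_relP qI 0.
have [e1 f1 g1] := quaternion_relP qI 1.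
have [e2 f2 g2] := quaternion_relP qI 2.
rewrite !add3E in f0 g0 f1 g1 f2 g2.
have H : - 1%:M + - 1%:M = (- (2 * true%:R))%:M :> 'M[R]_d.
  by rewrite mulr1 -[2]/(1 + 1) opprD raddfD raddfN.
by apply: ord3P; apply: ord3P;
  rewrite ?e0 ?e1 ?e2 ?f0 ?f1 ?f2 ?g0 ?g1 ?g2 ?subrr ?addNr ?mulr0 ?oppr0 ?raddf0.
Qed.

Lemma rot_inv A (c s : R) : A *m A = - 1%:M -> c ^+ 2 + s ^+ 2 = 1 ->
  (c%:M - s *: A) *m (c%:M + s *: A) = 1%:M.
Proof.
move=> AA cs; rewrite -(scalemx1 d c) mulmxDr !mulmxBl.
rewrite -!scalemxAl -!scalemxAr !mul1mx !mulmx1 AA !scalerA.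
by rewrite [s * c]mulrC !scalerN opprK addrA subrK -scalerDl -!expr2 cs scale1r.
Qed.

Lemma rot_expand A B (c s : R) :
  (c%:M + s *: A) *m B *m (c%:M - s *: A) =
  (c ^+ 2) *: B + (c * s) *: (A *m B - B *m A) - (s ^+ 2) *: (A *m B *m A).
Proof.
rewrite -(scalemx1 d c) mulmxDl mulmxBr !mulmxDl.
rewrite -!scalemxAl -!scalemxAr !mul1mx !mulmx1 !scalerDr !scalerA.
by rewrite scalerN opprD !expr2 [s * c]mulrC !addrA.
Qed.

Lemma rot_conj K K' A B (c s : R) : K' *m K = 1%:M ->
  K *m ((c%:M + s *: A) *m B *m (c%:M - s *: A)) *m K' =
  (c%:M + s *: (K *m A *m K')) *m (K *m B *m K') *m
  (c%:M - s *: (K *m A *m K')).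
Proof.
move=> KK.
have L : (c%:M + s *: (K *m A *m K')) *m K = K *m (c%:M + s *: A).
  rewrite mulmxDl mulmxDr mul_scalar_mx mul_mx_scalar -scalemxAl -scalemxAr.
  by rewrite -(mulmxA _ K') KK mulmx1.
have L' : K' *m (c%:M - s *: (K *m A *m K')) = (c%:M - s *: A) *m K'.
  rewrite mulmxBl mulmxBr mul_scalar_mx mul_mx_scalar -scalemxAl -scalemxAr.
  by rewrite !mulmxA KK mul1mx.
rewrite -[RHS]mulmxA -(mulmxA (K *m B) K') L' -(mulmxA K B) [RHS]mulmxA L.
by rewrite !mulmxA.
Qed.

Lemma quaternion_rel_conj I K K' : K' *m K = 1%:M -> K *m K' = 1%:M ->
  quaternion_rel I -> quaternion_rel (fun a => K *m I a *m K').
Proof.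
move=> KK KK' [sq I012].
have cm A B : K *m A *m K' *m (K *m B *m K') = K *m (A *m B) *m K'.
  by rewrite !mulmxA -(mulmxA _ K' K) KK mulmx1.
split=> [a|]; first by rewrite cm sq mulmxN mulmx1 mulNmx KK'.
by rewrite !cm I012 mulmxN mulmx1 mulNmx KK'.
Qed.

(** In [rot_expand] the commutator is handled by [commutator_sum], and [I a *m I b *m I a] becomes a
    combination of [I a] and [I b] by anticommutation. *)
Lemma rot_qspan I (a b : 'I_3) (c s : R) : quaternion_rel I ->
  qspan I ((c%:M + s *: I a) *m I b *m (c%:M - s *: I a)).
Proof.
move=> qI; rewrite rot_expand.
have H1 : qspan I (I a *m I b - I b *m I a).
  have := commutator_sum (fun e => (e == a)%:R) b qI.
  rewrite (bigD1 a) //= eqxx scale1r big1 ?addr0; last first.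
    by move=> e /negbTE ->; rewrite scale0r.
  move=> ->; apply: qspanD; first exact: qspan_gen.
  rewrite -scaleNr -[_ *: _]addr0.
  by apply: qspanD; [apply: qspan_gen|apply: qspan0].
have H2 : qspan I (I a *m I b *m I a).
  have := congr1 (mulmx^~ (I a)) (quaternion_anticomm qI a b).
  rewrite mulmxDl -(mulmxA (I b)) qI.1 mulmxN mulmx1 mul_scalar_mx => /eqP.
  by rewrite subr_eq => /eqP ->; apply: qspanD; apply: qspan_gen.
rewrite -addrA; apply: qspanD; first exact: qspan_gen.
apply: qspanD => //.
by rewrite -scaleNr -[_ *: _]addr0; apply: qspanD => //; apply: qspan0.
Qed.

End FrameRotation.

(** * The action of one-parameter subgroups on the Swann bundle *)

Section SwannBundle.
Context {R : realType} {d : nat} {M : manifold R d}.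
Context (Q : M -> set 'M[R]_d) (d_gt0 : (0 < d)%N) (aQ : almost_quaternionic Q).
Implicit Types (u : frame_point M) (X : ambient R d) (a b : 'I_3).

(** An admissible frame lies in the span of a local frame of [Q], and by [qspan_frame] it spans all
    of it. *)
Lemma swann_qspan u : swann Q u -> Q (fbase u) = qspan (fframe u).
Proof.
move=> [_ [QI qI] _]; have [U [J [_ Up _ /(_ _ Up)[qJ QJ]]]] := aQ (fbase u).
apply/seteqP; split=> A; rewrite QJ => HA.
  apply: (qspan_frame d_gt0 qI qJ) => // a.
  by have := QI a; rewrite QJ.
case: HA => x ->; apply: qspan_sum => a.
by have := QI a; rewrite QJ.
Qed.

(** The action of [exp (r e_a)]; its velocity at [r = 0] is [Zi u a]. *)
Definition rotate a (r : R) u : frame_point M :=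
  qact u (cos r) (fun b => if b == a then sin r else 0).

Definition rescale (r : R) u : frame_point M := qact u (expR r) (fun=> 0).

Lemma rotateE a r u : rotate a r u = FramePoint (fbase u) (fscale u)
  [ffun b => ((cos r)%:M + sin r *: fframe u a) *m fframe u b
             *m ((cos r)%:M - sin r *: fframe u a)].
Proof.
rewrite /rotate /qact.
have -> : \sum_b (if b == a then sin r else 0) *: fframe u b =
    sin r *: fframe u a.
  rewrite (bigD1 a) //= eqxx big1 ?addr0 // => b /negbTE ->.
  by rewrite scale0r.
have -> : \sum_b (if b == a then sin r else 0) ^+ 2 = sin r ^+ 2.
  rewrite (bigD1 a) //= eqxx big1 ?addr0 // => b /negbTE ->.
  by rewrite expr0n.
rewrite cos2Dsin2 sqrtr1 mul1r invr1; congr FramePoint.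
by apply/ffunP => b; rewrite !ffunE scale1r.
Qed.

Lemma rescaleE r u :
  rescale r u = FramePoint (fbase u) (expR r * fscale u) (fframe u).
Proof.
rewrite /rescale /qact.
rewrite [X in _ + X]big1 ?addr0; last by move=> b _; rewrite expr0n.
rewrite sqrtr_sqr ger0_norm ?expR_ge0 //; congr FramePoint.
apply/ffunP => b; rewrite ffunE big1; last by move=> e _; rewrite scale0r.
rewrite addr0 subr0 mul_scalar_mx mul_mx_scalar !scalerA -mulrA -expr2.
rewrite mulVf ?scale1r //.
by rewrite expf_neq0 // gt_eqF ?expR_gt0.
Qed.

(** Conjugation by an invertible matrix preserves the quaternion relations, and [rot_qspan] keeps
    the frame in its span, the fibre of [Q]. *)
Lemma swann_rotate a r u : swann Q u -> swann Q (rotate a r u).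
Proof.
move=> su; have QE := swann_qspan su; case: su => [t0 [QI qI] I01].
rewrite rotateE; set G := _%:M + _; set G' := _%:M - _.
have G'G : G' *m G = 1%:M by apply: rot_inv; [exact: qI.1|exact: cos2Dsin2].
have GG' : G *m G' = 1%:M by apply: mulmx1C.
split=> //=.
  split=> [b|]; first by rewrite ffunE QE; apply: rot_qspan.
  have := quaternion_rel_conj G'G GG' qI; congr quaternion_rel.
  by apply/funext => b; rewrite ffunE.
rewrite !ffunE !mulmxA -(mulmxA _ G' G) G'G mulmx1.
by rewrite -(mulmxA G) I01.
Qed.

Lemma swann_rescale r u : swann Q u -> swann Q (rescale r u).
Proof.
by move=> [t0 aI I01]; rewrite rescaleE; split=> //=; rewrite mulr_gt0 ?expR_gt0.
Qed.

Lemma coords_rotate p a r u b : cdom p (fbase u) ->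
  (coords p (rotate a r u)).2 b =
  ((cos r)%:M + sin r *: (coords p u).2 a) *m (coords p u).2 b
  *m ((cos r)%:M - sin r *: (coords p u).2 a).
Proof.
move=> pu; rewrite rotateE /coords /= !ffunE /=.
by apply: rot_conj; rewrite jacK.
Qed.

Lemma coords_self u a : (coords (fbase u) u).2 a = fframe u a.
Proof.
by rewrite ffunE jac_id ?mul1mx ?mulmx1 //; apply: cdom_refl.
Qed.

End SwannBundle.

(** * Tangent vectors of the Swann bundle *)

Section RotatingFamilies.
Context {R : realType} {d : nat} (x : R) (A B : R -> 'M[R]_d).

Let rotated (r : R) := ((cos (x * r))%:M + sin (x * r) *: A r) *m B r
  *m ((cos (x * r))%:M - sin (x * r) *: A r).

Lemma Ck_rotated k (U : set R) : open U -> Ck k U A -> Ck k U B ->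
  Ck k U rotated.
Proof.
move=> oU cA cB; have [cc cs] := Ck_trig k x oU.
have c1 : Ck k U (fun r => (cos (x * r))%:M : 'M[R]_d).
  apply: (Ck_ext oU _ (Ck_scalemx oU cc (Ck_cst k U (1%:M : 'M[R]_d)))) => r _.
  by rewrite scalemx1.
have cN : Ck k U (fun r => - sin (x * r)).
  apply: (Ck_ext oU _ (Ck_mul oU (Ck_cst k U (- 1 : R)) cs)) => r _.
  by rewrite mulN1r.
have := Ck_mulmx oU (Ck_mulmx oU (Ck_addmx oU c1 (Ck_scalemx oU cs cA)) cB)
  (Ck_addmx oU c1 (Ck_scalemx oU cN cA)).
by apply: Ck_ext => // r _; rewrite /rotated scaleNr.
Qed.

(** At [r = 0] the outer factors are the identity with derivatives [x *: A 0] and its opposite, the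
    derivative of [A] being killed by [sin 0 = 0]. *)
Lemma derive_rotated : differentiable A 0 -> differentiable B 0 ->
  'D_1 rotated 0 = 'D_1 B 0 + x *: (A 0 *m B 0 - B 0 *m A 0).
Proof.
move=> dA dB.
have icos := is_derive_scaled (is_derive_cos (x * 0)).
have isin := is_derive_scaled (is_derive_sin (x * 0)).
have dcos : differentiable (fun r : R => cos (x * r)) 0.
  by apply/derivable1_diffP; apply: ex_derive.
have dsin : differentiable (fun r : R => sin (x * r)) 0.
  by apply/derivable1_diffP; apply: ex_derive.
have d1 := differentiable_cst (1%:M : 'M[R]_d) (0 : R).
have C0 : 'D_1 (fun r => (cos (x * r))%:M : 'M[R]_d) 0 = 0.
  rewrite (_ : (fun r => _) = (fun r => cos (x * r) *: (1%:M : 'M[R]_d))).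
    rewrite (derive_scalemx (1 : R) dcos d1) derive_cst scaler0 addr0 derive_val.
    by rewrite mulr0 sin0 oppr0 mulr0 scale0r.
  by apply/funext => r; rewrite scalemx1.
have dC : differentiable (fun r => (cos (x * r))%:M : 'M[R]_d) 0.
  rewrite (_ : (fun r => _) = (fun r => cos (x * r) *: (1%:M : 'M[R]_d))).
    exact: differentiable_scalemx.
  by apply/funext => r; rewrite scalemx1.
pose S r := sin (x * r) *: A r.
have dS : differentiable S 0 by apply: differentiable_scalemx.
have S0 : 'D_1 S 0 = x *: A 0.
  rewrite (derive_scalemx (1 : R) dsin dA) derive_val.
  by rewrite mulr0 sin0 cos0 mulr1 scale0r addr0.
pose C r := (cos (x * r))%:M : 'M[R]_d.
have dP : differentiable (C + S) 0 by apply: differentiableD.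
have dN : differentiable (C - S) 0 by apply: differentiableB.
have P1 : 'D_1 (C + S) 0 = x *: A 0.
  by rewrite deriveD ?C0 ?S0 ?add0r //; apply: diff_derivable.
have N1 : 'D_1 (C - S) 0 = - (x *: A 0).
  by rewrite deriveB ?C0 ?S0 ?sub0r //; apply: diff_derivable.
have -> : rotated = (fun r => ((C + S) r *m B r) *m (C - S) r) by [].
rewrite (derive_mulmx (1 : R) (differentiable_mulmx dP dB) dN).
rewrite (derive_mulmx (1 : R) dP dB).
rewrite P1 N1 !fctE /C /S mulr0 cos0 sin0 scale0r addr0 subr0 mulmx1 !mul1mx.
rewrite mulmxN -scalemxAr -scalemxAl scalerBr.
by rewrite -addrA addrCA.
Qed.

End RotatingFamilies.

Section TangentVectors.
Context {R : realType} {d : nat} {M : manifold R d}.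
Context (Q : M -> set 'M[R]_d) (d_gt0 : (0 < d)%N) (aQ : almost_quaternionic Q).
Implicit Types (u : frame_point M) (X : ambient R d) (a b : 'I_3) (x : R).

Definition bracket_frame u a : {ffun 'I_3 -> 'M[R]_d} :=
  [ffun b => fframe u a *m fframe u b - fframe u b *m fframe u a].

Lemma open_itv0 (e : R) : 0 < e -> open [set r : R | `|r| < e].
Proof.
move=> e0; rewrite (_ : mkset _ = ball (0 : R) e); first exact: ball_open.
by apply/seteqP; split=> r /=; rewrite /ball /= sub0r normrN.
Qed.

Lemma frame_pointP u v : fbase u = fbase v -> fscale u = fscale v ->
  fframe u = fframe v -> u = v.
Proof. by case: u v => [p t f] [p' t' f'] /= -> -> ->. Qed.

(** Tangent vectors are velocities of curves, so a multiple of [Zi u a] is added to a velocity by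
    letting [exp (x r e_a)] act on the curve. *)
Lemma rotate_curve u c a x : smooth_curve Q u c ->
  smooth_curve Q u (fun r => rotate a (x * r) (c r)) /\
  velocity u (fun r => rotate a (x * r) (c r)) =
    velocity u c + x *: (0, 0, bracket_frame u a).
Proof.
move=> [c0 [e e0 /= [cs ct cz cf]]]; set J := mkset _ in cs ct cz cf.
have oJ : open J by apply: open_itv0.
have J0 : J 0 by rewrite /J /= normr0.
set p := fbase u in cs ct cz cf *.
have tE : (fun r => (coords p (rotate a (x * r) (c r))).1.1) =
          (fun r => (coords p (c r)).1.1).
  by apply/funext => r; rewrite rotateE.
have zE : (fun r => (coords p (rotate a (x * r) (c r))).1.2) =
          (fun r => (coords p (c r)).1.2).
  by apply/funext => r; rewrite rotateE.
(* Restricted to [J], where the base point stays in the chart domain as [coords_rotate] requires. *)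
have fE b r : J r -> _ = (coords p (rotate a (x * r) (c r))).2 b :=
  fun Jr => esym (coords_rotate a (x * r) b (cs r Jr).2).
split.
  split.
    rewrite c0 mulr0 rotateE; apply: frame_pointP => //=; apply/ffunP => b.
    by rewrite ffunE cos0 sin0 scale0r addr0 subr0 mul1mx mulmx1.
  exists e => //; rewrite -/J -/p; split.
  - move=> r Jr; have [sr pr] := cs r Jr; split; first exact: swann_rotate.
    by rewrite rotateE.
  - by rewrite tE.
  - by rewrite zE.
  - move=> b k; apply: (Ck_ext oJ (fE b)); apply: Ck_rotated => //; exact: cf.
rewrite /velocity -/p tE zE; congr (_, _, _); rewrite /= ?scaler0 ?addr0 //.
apply/ffunP => b; rewrite !ffunE.
have d0 b' : differentiable (fun r => (coords p (c r)).2 b') (0 : R).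
  by apply: (cf b' 1).1.
rewrite -(near_eq_derive _ (near_eq_on oJ J0 (fE b))).
rewrite (derive_rotated x (d0 a) (d0 b)); congr (_ + _ *: _).
by rewrite c0 !coords_self.
Qed.

Lemma rescale_curve u c x : smooth_curve Q u c ->
  smooth_curve Q u (fun r => rescale (x * r) (c r)) /\
  velocity u (fun r => rescale (x * r) (c r)) =
    velocity u c + x *: (fscale u, 0, 0).
Proof.
move=> [c0 [e e0 /= [cs ct cz cf]]]; set J := mkset _ in cs ct cz cf.
have oJ : open J by apply: open_itv0.
have J0 : J 0 by rewrite /J /= normr0.
set p := fbase u in cs ct cz cf *.
have tE : (fun r => (coords p (rescale (x * r) (c r))).1.1) =
          (fun r => expR (x * r) * (coords p (c r)).1.1).
  by apply/funext => r; rewrite rescaleE.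
have zE : (fun r => (coords p (rescale (x * r) (c r))).1.2) =
          (fun r => (coords p (c r)).1.2).
  by apply/funext => r; rewrite rescaleE.
have fE b : (fun r => (coords p (rescale (x * r) (c r))).2 b) =
            (fun r => (coords p (c r)).2 b).
  by apply/funext => r; rewrite rescaleE.
split.
  split.
    rewrite c0 mulr0 rescaleE; apply: frame_pointP => //=.
    by rewrite expR0 mul1r.
  exists e => //; rewrite -/J -/p; split.
  - move=> r Jr; have [sr pr] := cs r Jr; split; first exact: swann_rescale.
    by rewrite rescaleE.
  - by rewrite tE => k; apply: Ck_mul => //; apply: Ck_expR.
  - by rewrite zE.
  - by move=> b; rewrite fE.
have iexp := is_derive_scaled (is_derive_expR (x * (0 : R))).
have dexp : differentiable (fun r : R => expR (x * r)) 0.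
  by apply/derivable1_diffP; apply: ex_derive.
have dt := (ct 1).1 0 J0.
rewrite /velocity -/p tE zE; congr (_, _, _); rewrite /= ?scaler0 ?addr0 //.
  rewrite (derive_mulE (1 : R) dexp dt) derive_val mulr0 expR0 mulr1 mul1r addrC.
  by rewrite /= c0.
by apply/ffunP => b; rewrite !ffunE fE.
Qed.

Lemma constant_curve u : swann Q u ->
  smooth_curve Q u (fun _ => u) /\ velocity u (fun _ => u) = 0.
Proof.
move=> su; split.
  split=> //; exists 1 => //=; split.
  - by move=> r _; split=> //; apply: cdom_refl.
  - by move=> k; apply: Ck_cst.
  - by move=> k; apply: Ck_cst.
  - by move=> a k; apply: Ck_cst.
rewrite /velocity !derive_cst; congr (_, _, _).
by apply/ffunP => b; rewrite !ffunE derive_cst.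
Qed.

Lemma ZiE u a : swann Q u -> Zi u a = (0, 0, bracket_frame u a).
Proof.
move=> /constant_curve [sc v0]; have [_] := rotate_curve a 1 sc.
rewrite v0 scale1r add0r => <-; congr velocity.
by apply/funext => r; rewrite mul1r.
Qed.

Lemma Z0E u : swann Q u -> Z0 u = (fscale u, 0, 0).
Proof.
move=> /constant_curve [sc v0]; have [_] := rescale_curve 1 sc.
rewrite v0 scale1r add0r => <-; congr velocity.
by apply/funext => r; rewrite mul1r.
Qed.

Lemma tangent0 u : swann Q u -> tangent Q u 0.
Proof. by move=> /constant_curve [sc v0]; exists (fun=> u). Qed.

Lemma tangent_addZi u X a x : swann Q u -> tangent Q u X ->
  tangent Q u (X + x *: Zi u a).
Proof.
move=> su [c sc ->]; have [sc' e] := rotate_curve a x sc.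
by exists (fun r => rotate a (x * r) (c r)); rewrite // e ZiE.
Qed.

Lemma tangent_addZ0 u X x : swann Q u -> tangent Q u X ->
  tangent Q u (X + x *: Z0 u).
Proof.
move=> su [c sc ->]; have [sc' e] := rescale_curve x sc.
by exists (fun r => rescale (x * r) (c r)); rewrite // e Z0E.
Qed.

End TangentVectors.

(** * The connection form *)

Section CovariantDerivative.
Context {R : realType} {d : nat} {M : manifold R d}.
Context (Q : M -> set 'M[R]_d) (d_gt0 : (0 < d)%N) (aQ : almost_quaternionic Q).
Context (nabla : connection_op M) (conn : is_connection nabla).
Context (presQ : preserves nabla Q).
Implicit Types (u : frame_point M) (X : ambient R d) (a b : 'I_3).

Lemma qspan_conj (I : 'I_3 -> 'M[R]_d) (K K' A : 'M[R]_d) : qspan I A ->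
  qspan (fun a => K *m I a *m K') (K *m A *m K').
Proof.
case=> x ->; exists x; rewrite mulmx_sumr mulmx_suml.
by apply: eq_bigr => a _; rewrite -scalemxAr -scalemxAl.
Qed.

(** The Leibniz rule for the commutator with [G], used to gather the Christoffel terms of a
    product. *)
Lemma commutator_mulmx (G A B : 'M[R]_d) :
  (G *m A - A *m G) *m B + A *m (G *m B - B *m G) =
  G *m (A *m B) - A *m B *m G.
Proof. by rewrite mulmxBl mulmxBr !mulmxA addrA subrK. Qed.

(** Smoothness of a curve is known through its coordinates, so the base point is recovered by the
    continuous inverse chart. *)
Lemma near_base U u c : open U -> U (fbase u) -> smooth_curve Q u c ->
  \forall r \near (0 : R), [/\ U (fbase (c r)), swann Q (c r) &
    cdom (fbase u) (fbase (c r))].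
Proof.
move=> oU Up [c0 [e e0 /= [cs _ cz _]]]; set J := mkset _ in cs cz.
have J0 : J 0 by rewrite /J /= normr0.
have nJ : nbhs (0 : R) J by apply: open_nbhs_nbhs; split=> //; apply: open_itv0.
set p := fbase u in cs cz Up *.
have pO : (chart p @` cdom p) (coords p (c 0)).1.2.
  by rewrite c0; exists p => //; apply: cdom_refl.
have nU : \forall r \near (0 : R), U (chart_inv p (coords p (c r)).1.2).
  apply: (continuous_comp (cz 0 0 J0) (chart_inv_continuous pO)).
  apply: open_nbhs_nbhs; split=> //.
  by rewrite /= c0 chartK //; apply: cdom_refl.
apply: filterS2 nJ nU => r Jr; have [sr pr] := cs r Jr.
by rewrite /= chartK.
Qed.

(** Along the curve, the frame vector is a combination of a local frame [J] of [Q] with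
    differentiable coefficients; differentiating a coefficient stays in the span of [J], and
    differentiating [J] covariantly stays in [Q]. *)
Lemma cov_frame_span u X a : swann Q u -> tangent Q u X ->
  qspan (fframe u) (cov_frame nabla u X a).
Proof.
move=> su [c sc ->]; rewrite -(swann_qspan d_gt0 aQ su).
set p := fbase u; have [U [J [oU Up sJ HJ]]] := aQ p.
have near0 := near_base oU Up sc; rewrite -/p in near0.
have [qJ QJ] := HJ p Up.
case: sc => c0 [e e0 /= [cs ct cz cf]]; set O := mkset _ in cs ct cz cf.
have oO : open O by apply: open_itv0.
have O0 : O 0 by rewrite /O /= normr0.
pose z r := (coords p (c r)).1.2; pose F r := (coords p (c r)).2 a.
have dz : differentiable z (0 : R) by apply: (cz 1).1.
have dF : differentiable F (0 : R) by apply: (cf a 1).1.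
have z0 : z 0 = chart p p by rewrite /z c0.
have F0 : F 0 = fframe u a by rewrite /F c0 coords_self.
pose v := 'D_1 z (0 : R).
pose Jz b r := end_in p (J b) (z r).
have dJ b : differentiable (end_in p (J b)) (chart p p).
  exact: end_in_differentiable oU Up (sJ b).
have dJz b : differentiable (Jz b) (0 : R).
  by apply: (differentiable_comp dz); rewrite z0.
have DJz b : 'D_1 (Jz b) (0 : R) = 'D_v (end_in p (J b)) (chart p p).
  exact: derive_compE z0 dz (dJ b).
have Jz0 b : Jz b 0 = J b p by rewrite /Jz z0 end_in_at.
(* The trace coefficients of [qspan_proj], in the fixed chart around [p]. *)
pose y b r := - d%:R^-1 * \tr (F r *m Jz b r).
have dy b : differentiable (y b) (0 : R).
  apply: (@differentiableM _ _ (cst (- d%:R^-1 : R))).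
    exact: differentiable_cst.
  exact/differentiable_mxtrace/differentiable_mulmx.
have FJ : \forall r \near (0 : R), F r = (\sum_b (fun r => y b r *: Jz b r)) r.
  apply: filterS near0 => r [Ur [_ [QI _] _] pr].
  have [qJr QJr] := HJ _ Ur; have := QI a; rewrite QJr => IJ.
  set q := fbase (c r) in Ur pr qJr QJr IJ.
  have JzE b : Jz b r = jac q p q *m J b q *m jac p q q.
    by rewrite /Jz /end_in /z /= chartK.
  have qz : quaternion_rel (Jz ^~ r).
    have := quaternion_rel_conj (jacK pr) (jacKV pr) qJr.
    by congr quaternion_rel; apply/funext => b; rewrite JzE.
  have sz : qspan (Jz ^~ r) (F r).
    have := qspan_conj (jac q p q) (jac p q q) IJ.
    rewrite (_ : (fun b => _) = Jz ^~ r); last by apply/funext => b; rewrite JzE.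
    by rewrite /F /= ffunE.
  by rewrite fct_sumE; apply: (qspan_proj d_gt0 qz sz).
have DF : 'D_1 F (0 : R) = \sum_b ('D_1 (y b) (0 : R) *: J b p +
    y b 0 *: 'D_v (end_in p (J b)) (chart p p)).
  rewrite (near_eq_derive _ FJ) derive_sum; last first.
    by move=> b; apply/diff_derivable/differentiable_scalemx.
  apply: eq_bigr => b _.
  by rewrite (derive_scalemx (1 : R) (dy b) (dJz b)) DJz Jz0.
have I0 : fframe u a = \sum_b y b 0 *: J b p.
  rewrite -F0 (nbhs_singleton FJ) fct_sumE.
  by apply: eq_bigr => b _; rewrite Jz0.
pose G := christoffel nabla p v.
have JQ b q : U q -> Q q (J b q).
  by move=> Uq; rewrite (HJ q Uq).2; apply: qspan_gen.
have nJ b : qspan (J ^~ p) ('D_v (end_in p (J b)) (chart p p)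
    + G *m J b p - J b p *m G).
  have [B QB nB] := presQ v oU Up (sJ b) (JQ b).
  by rewrite -(nabla_endE conn oU Up (sJ b) nB) -[qspan _]QJ.
rewrite QJ -[mkset _]/(qspan (J ^~ p)).
(* The product rule, with the commutator by [G] distributed over the local frame so that each
   covariant derivative of [J b] appears whole. *)
have -> : cov_frame nabla u (velocity u c) a =
    \sum_b 'D_(1 : R) (y b) (0 : R) *: J b p + \sum_b y b 0 *:
    ('D_v (end_in p (J b)) (chart p p) + G *m J b p - J b p *m G).
  rewrite /cov_frame ffunE /dproj /= ffunE -/p -/v -/G -[LHS]addrA.
  rewrite [X in X + _]DF I0 big_split /= -addrA; congr (_ + _).
  rewrite mulmx_sumr mulmx_suml -sumrB -big_split; apply: eq_bigr => b _ /=.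
  by rewrite -scalemxAr -scalemxAl -scalerBr -scalerDr addrA.
rewrite -[X in X + _]scale1r; apply: qspanD.
  by apply: qspan_sum => b; apply: qspan_gen.
exact: qspan_sum.
Qed.

(** The covariant derivative of [quaternion_anticomm], whose right-hand side is a constant scalar
    matrix. *)
Lemma cov_frame_anticomm u X a b : swann Q u -> tangent Q u X ->
  let C := cov_frame nabla u X in
  C a *m fframe u b + fframe u a *m C b +
    (C b *m fframe u a + fframe u b *m C a) = 0.
Proof.
move=> su [c sc ->] C.
have near0 := near_base openT I sc.
set p := fbase u in near0 *; have [_ [_ qI] _] := su.
case: sc => c0 [e e0 /= [cs ct cz cf]]; set O := mkset _ in cs ct cz cf.
have oO : open O by apply: open_itv0.
have O0 : O 0 by rewrite /O /= normr0.
pose F a r := (coords p (c r)).2 a.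
have dF a' : differentiable (F a') (0 : R) by apply: (cf a' 1).1.
have F0 a' : F a' 0 = fframe u a' by rewrite /F c0 coords_self.
pose s : 'M[R]_d := (- (2 * (a == b)%:R))%:M.
have Fs : \forall r \near (0 : R), cst s r =
    ((fun r => F a r *m F b r) + (fun r => F b r *m F a r)) r.
  apply: filterS near0 => r [_ [_ [_ qIr] _] pr].
  have qF : quaternion_rel (F ^~ r).
    have := quaternion_rel_conj (jacK pr) (jacKV pr) qIr; congr quaternion_rel.
    by apply/funext => l; rewrite /F /= ffunE.
  exact: esym (quaternion_anticomm qF a b).
have := near_eq_derive (1 : R) Fs; rewrite derive_cst deriveD; first last.
- by apply/diff_derivable/differentiable_mulmx.
- by apply/diff_derivable/differentiable_mulmx.
rewrite !derive_mulmx // !F0 => DF0.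
pose G := christoffel nabla p ('D_1 (fun r => (coords p (c r)).1.2) (0 : R)).
have CE l : C l = 'D_1 (F l) (0 : R) + (G *m fframe u l - fframe u l *m G).
  by rewrite /C /cov_frame ffunE /dproj /= ffunE addrA.
have E k l : C k *m fframe u l + fframe u k *m C l =
    'D_1 (F k) (0 : R) *m fframe u l + fframe u k *m 'D_1 (F l) (0 : R)
    + (G *m (fframe u k *m fframe u l) - fframe u k *m fframe u l *m G).
  by rewrite !CE mulmxDl mulmxDr addrACA commutator_mulmx.
(* The ordinary derivatives cancel by [DF0]; what remains is the commutator of [G] with a scalar
   matrix. *)
rewrite !E addrACA -DF0 add0r addrACA -mulmxDr -opprD -mulmxDl.
by rewrite quaternion_anticomm // mul_scalar_mx mul_mx_scalar subrr.
Qed.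

Lemma cov_frame_tangent u X : swann Q u -> tangent Q u X ->
  exists x : {ffun 'I_3 -> R},
    cov_frame nabla u X = \sum_a x a *: bracket_frame u a.
Proof.
move=> su tX; have [_ [_ qI] _] := su.
have [x xE] := frame_derivation d_gt0 qI (fun a => cov_frame_span a su tX)
  (fun a b => cov_frame_anticomm a b su tX).
exists x; apply/ffunP => a; rewrite xE sum_ffunE.
by apply: eq_bigr => b _; rewrite !ffunE.
Qed.

End CovariantDerivative.

(** * The connection form, the complex structures and the forms [beta_] in components *)

Section VerticalForms.
Context {R : realType} {d : nat} {M : manifold R d}.
Context (Q : M -> set 'M[R]_d) (d_gt0 : (0 < d)%N) (aQ : almost_quaternionic Q).
Context (nabla : connection_op M) (conn : is_connection nabla).
Context (presQ : preserves nabla Q) (u : frame_point M) (su : swann Q u).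
Implicit Types (X Y Z : ambient R d) (a b c : 'I_3).

Local Notation t := (fscale u).
Local Notation th := (theta nabla u).

Lemma scale_neq0 : t != 0.
Proof. by have [t0 _ _] := su; rewrite gt_eqF. Qed.

Lemma cov_frameP k X Y : cov_frame nabla u (k *: X + Y) =
  k *: cov_frame nabla u X + cov_frame nabla u Y.
Proof.
apply/ffunP => a; rewrite !ffunE /dproj /= christoffelP //.
rewrite mulmxDl mulmxDr -scalemxAl -scalemxAr opprD !scalerDr scalerN.
by rewrite (addrACA (k *: _)) [LHS]addrACA.
Qed.

(** Infinitesimal freeness of the rotation action, which makes the value chosen by [xget] in [theta]
    unique. *)
Lemma bracket_free (x y : {ffun 'I_3 -> R}) :
  \sum_a x a *: bracket_frame u a = \sum_a y a *: bracket_frame u a -> x = y.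
Proof.
move=> exy; have [_ [_ qI] _] := su; apply/ffunP => a; apply/eqP.
rewrite -subr_eq0; apply/eqP; move: a.
apply: (commutator_sum_eq0 d_gt0 (I := fframe u)) => // b.
have /ffunP /(_ b) : \sum_a (x a - y a) *: bracket_frame u a = 0.
  by under eq_bigr do rewrite scalerBl; rewrite sumrB exy subrr.
rewrite sum_ffunE [X in _ = X]ffunE => e; apply: etrans e; apply: eq_bigr => c _.
by rewrite !ffunE.
Qed.

Lemma thetaE X (x : {ffun 'I_3 -> R}) :
  cov_frame nabla u X = \sum_a x a *: bracket_frame u a -> th X = x.
Proof.
move=> ex; have ex' : cov_frame nabla u X = \sum_a x a *: (Zi u a).2.
  by rewrite ex; apply: eq_bigr => a _; rewrite (ZiE d_gt0 aQ).
have H : cov_frame nabla u X = \sum_a th X a *: (Zi u a).2.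
  exact: (@xgetPex _ 0 [set y : {ffun 'I_3 -> R} |
    cov_frame nabla u X = \sum_a y a *: (Zi u a).2] (ex_intro _ x ex')).
apply: bracket_free; rewrite -ex H.
by apply: eq_bigr => a _; rewrite (ZiE d_gt0 aQ).
Qed.

(** Says that [theta] solves its defining equation at [X] instead of taking its default value [0].
    It holds on tangent vectors and passes to linear combinations directly. *)
Definition has_theta X :=
  cov_frame nabla u X = \sum_a th X a *: bracket_frame u a.

Lemma tangent_theta X : tangent Q u X -> has_theta X.
Proof.
move=> /(cov_frame_tangent d_gt0 aQ conn presQ su)[x xE].
by rewrite /has_theta (thetaE xE).
Qed.

Lemma thetaP k X Y : has_theta X -> has_theta Y ->
  has_theta (k *: X + Y) /\ forall a, th (k *: X + Y) a = k * th X a + th Y a.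
Proof.
move=> hX hY.
have E : cov_frame nabla u (k *: X + Y) =
    \sum_a [ffun b => k * th X b + th Y b] a *: bracket_frame u a.
  rewrite cov_frameP hX hY scaler_sumr -big_split; apply: eq_bigr => a _ /=.
  by rewrite ffunE scalerA scalerDl.
have e := thetaE E; split=> [|a]; first by rewrite /has_theta e.
by rewrite e ffunE.
Qed.

(** Over a zero base velocity the Christoffel term vanishes, so the covariant derivative is the
    velocity of the frame. *)
Lemma theta_vertical x (y : {ffun 'I_3 -> R}) :
  let X := (x, 0, \sum_a y a *: bracket_frame u a) in has_theta X /\ th X = y.
Proof.
move=> X; have E : cov_frame nabla u X = \sum_a y a *: bracket_frame u a.
  apply/ffunP => b; rewrite ffunE /dproj /= christoffel0 //.
  by rewrite mul0mx mulmx0 addr0 subr0.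
by have e := thetaE E; rewrite /has_theta e.
Qed.

Lemma theta_zero : th 0 = 0.
Proof.
have [_] := theta_vertical 0 0; rewrite big1 // => a _.
by rewrite ffunE scale0r.
Qed.

Lemma horizontal0 : horizontal Q nabla u 0.
Proof.
by split; [exact: tangent0|rewrite /theta0 mul0r|exact: theta_zero].
Qed.

(** Either [xget] returns a horizontal lift or its default [0], which is horizontal too. *)
Lemma horizontal_hlift v : horizontal Q nabla u (hlift Q nabla u v).
Proof.
rewrite /hlift; case: xgetP => [X _ [] //|_]; exact: horizontal0.
Qed.

(** A horizontal vector over [0] vanishes: its frame velocity is its covariant derivative, and
    [theta0] detects the scale component since [t] is nonzero. *)
Lemma hlift0 : hlift Q nabla u 0 = 0.
Proof.
rewrite /hlift; case: xgetP => // -[[x v] f] _ [[tX x0 thX] v0].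
rewrite /dproj /= in v0; rewrite v0 in tX x0 thX *.
have f0 : f = 0.
  have := tangent_theta tX; rewrite /has_theta thX big1 => [|a _]; last first.
    by rewrite ffunE scale0r.
  move=> /ffunP f0; apply/ffunP => a; have := f0 a.
  by rewrite ffunE /dproj /= christoffel0 // mul0mx mulmx0 addr0 subr0.
rewrite f0; congr (_, _, _); move/eqP: x0; rewrite /theta0 /=.
by rewrite mulf_eq0 invr_eq0 (negbTE scale_neq0) orbF => /eqP.
Qed.

Lemma Zi_bracketE a : Zi u a =
  (0, 0, \sum_b [ffun c => (c == a)%:R : R] b *: bracket_frame u b).
Proof.
rewrite (ZiE d_gt0 aQ) //; congr (_, _, _).
rewrite (bigD1 a) //= ffunE eqxx scale1r big1 ?addr0 // => b /negbTE ba.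
by rewrite ffunE ba scale0r.
Qed.

Lemma has_theta_Zi a : has_theta (Zi u a).
Proof. by rewrite Zi_bracketE; apply: (theta_vertical 0 _).1. Qed.

Lemma theta_Zi a b : th (Zi u a) b = (b == a)%:R.
Proof. by rewrite Zi_bracketE (theta_vertical 0 _).2 ffunE. Qed.

Lemma Z0_bracketE : Z0 u =
  (t, 0, \sum_b (0 : {ffun 'I_3 -> R}) b *: bracket_frame u b).
Proof.
rewrite (Z0E su); congr (_, _, _).
by rewrite big1 // => b _; rewrite ffunE scale0r.
Qed.

Lemma has_theta_Z0 : has_theta (Z0 u).
Proof. by rewrite Z0_bracketE; apply: (theta_vertical t 0).1. Qed.

Lemma theta_Z0 : th (Z0 u) = 0.
Proof. by rewrite Z0_bracketE (theta_vertical t 0).2. Qed.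

(** The sum is nested in the shape [k *: X + Y] of [theta0P] and [thetaP], which never see more of
    [h] than its horizontality. *)
Lemma Ihat_expand a X : exists2 h, horizontal Q nabla u h &
  Ihat Q nabla u a X = (- theta0 u X) *: Zi u a + (th X a *: Z0 u +
   (th X (a + 1) *: Zi u (a + 2) + ((- th X (a + 2)) *: Zi u (a + 1) + h))).
Proof.
exists (hlift Q nabla u (fframe u a *m dproj X)); first exact: horizontal_hlift.
rewrite /Ihat; move: (hlift _ _ _ _) => h.
move: (Zi u a) (Z0 u) (Zi u (a + 1)) (Zi u (a + 2)) => za z0 zb zc.
by rewrite !scalerN !scaleNr !addrA.
Qed.

Lemma theta0P k X Y : theta0 u (k *: X + Y) = k * theta0 u X + theta0 u Y.
Proof. by rewrite /theta0 mulrA -mulrDl. Qed.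

Lemma theta0_Z0 : theta0 u (Z0 u) = 1.
Proof. by rewrite Z0_bracketE /theta0 divff // scale_neq0. Qed.

Lemma theta0_Zi a : theta0 u (Zi u a) = 0.
Proof. by rewrite Zi_bracketE /theta0 mul0r. Qed.

Lemma theta0_Ihat a X : theta0 u (Ihat Q nabla u a X) = th X a.
Proof.
have [h [_ h0 _] ->] := Ihat_expand a X; move: theta0_Z0 theta0_Zi.
move: (Z0 u) (Zi u) => z0 z z00 zi0.
by rewrite !theta0P h0 !zi0 z00 !mulr0 mulr1 !addr0 add0r.
Qed.

Lemma theta_Ihat a X b : th (Ihat Q nabla u a X) b =
    - theta0 u X * (b == a)%:R + th X (a + 1) * (b == a + 2)%:R
    - th X (a + 2) * (b == a + 1)%:R.
Proof.
have [h [/tangent_theta H0 _ hth] ->] := Ihat_expand a X.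
have := theta_Zi; move: has_theta_Zi has_theta_Z0 theta_Z0.
move: (Z0 u) (Zi u) => z0 z Hz Hz0 thz0 thz.
have [H1 E1] := thetaP (- th X (a + 2)) (Hz (a + 1)) H0.
have [H2 E2] := thetaP (th X (a + 1)) (Hz (a + 2)) H1.
have [H3 E3] := thetaP (th X a) Hz0 H2.
have [H4 E4] := thetaP (- theta0 u X) (Hz a) H3.
rewrite E4 E3 E2 E1 !thz thz0 hth ![(0 : {ffun _}) _]ffunE.
by rewrite mulr0 add0r addr0 !mulNr addrA.
Qed.

Lemma beta_E a X Y : beta_ nabla u a X Y = t^-2 *
  (theta0 u X * th Y a - theta0 u Y * th X a
   + (th X (a + 1) * th Y (a + 2) - th X (a + 2) * th Y (a + 1))).
Proof.
rewrite /beta_ /wedge /alpha0 /alphai /theta0.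
by field; exact: scale_neq0.
Qed.

Lemma beta_vertical_hermitian a : vertical_hermitian Q nabla u (beta_ nabla u a).
Proof.
have linth k X Y : tangent Q u X -> tangent Q u Y ->
    forall b, th (k *: X + Y) b = k * th X b + th Y b.
  by move=> /tangent_theta hX /tangent_theta hY; case: (thetaP k hX hY).
split.
- split=> [k X Y Z tX tY tZ|X Y _ _]; rewrite !beta_E.
    rewrite (theta0P k X Y) !(linth k X Y tX tY).
    move: (theta0 u X) (theta0 u Y) (theta0 u Z) (th X) (th Y) (th Z).
    by move=> x0 y0 z0 x y z; ring.
  move: (theta0 u X) (theta0 u Y) (th X) (th Y) => x0 y0 x y; ring.
- move=> b X Y _ _; rewrite !beta_E; congr (_ * _).
  (* In components, [Ihat b] is a fixed linear map of [R^4], so invariance is a polynomial identity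
     for each of the nine pairs of indices. *)
  have := theta_Ihat b; have := theta0_Ihat b.
  move: (Ihat Q nabla u b) => J J0 Ji; rewrite !J0 !Ji {J J0 Ji}.
  move: (theta0 u X) (theta0 u Y) (th X) (th Y) => x0 y0 x y.
  by move: a b; apply: ord3P; apply: ord3P; rewrite !add3E /=; ring.
- move=> X Y [_ X0 Xth] [_ Y0 Yth]; rewrite beta_E X0 Y0 Xth Yth !ffunE.
  by rewrite !mul0r subrr addr0 mulr0.
- move=> X Y [_ X0 Xth] _; rewrite beta_E X0 Xth !ffunE.
  by rewrite !mul0r mulr0 !subrr addr0 mulr0.
Qed.

Lemma tangent_Zi a : tangent Q u (Zi u a).
Proof.
by have := tangent_addZi d_gt0 aQ a 1 su (tangent0 su); rewrite add0r scale1r.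
Qed.

Lemma tangent_Z0 : tangent Q u (Z0 u).
Proof.
by have := tangent_addZ0 1 su (tangent0 su); rewrite add0r scale1r.
Qed.

Lemma dproj_Zi a : dproj (Zi u a) = 0. Proof. by rewrite Zi_bracketE. Qed.
Lemma dproj_Z0 : dproj (Z0 u) = 0. Proof. by rewrite Z0_bracketE. Qed.


End VerticalForms.

(** * Vertical Hermitian forms *)

Section HermitianForms.
Context {R : realType} {V : lmodType R}.
Context (T : V -> Prop) (x0 : V -> R) (x : V -> 'I_3 -> R).
Context (z0 : V) (z : 'I_3 -> V).
Implicit Types (X Y Z : V) (a : 'I_3) (k : R) (l : 'I_3 -> R).

(** The sum is built by successive additions because [T], which stands for tangency, is only assumed
    to contain [0] and to be stable under adding multiples of [z0] and of the [z a]. *)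
Definition shift X k l : V :=
  X + k *: z0 + l 0 *: z 0 + l 1 *: z 1 + l 2 *: z 2.

Context (T0 : T 0) (Tz0 : forall k X, T X -> T (X + k *: z0)).
Context (Tz : forall k a X, T X -> T (X + k *: z a)).
Context (x0D : forall k X Y, T X -> T Y -> x0 (X + k *: Y) = x0 X + k * x0 Y).
Context (xD : forall k X Y, T X -> T Y ->
  forall a, x (X + k *: Y) a = x X a + k * x Y a).
Context (x0z0 : x0 z0 = 1) (x0z : forall a, x0 (z a) = 0).
Context (xz0 : forall a, x z0 a = 0).
Context (xz : forall a e, x (z a) e = (e == a)%:R).
Context (H : V -> Prop).
Context (HP : forall X, H X <-> [/\ T X, x0 X = 0 & forall a, x X a = 0]).

Lemma Tz0_0 : T z0.
Proof. by have := Tz0 1 T0; rewrite add0r scale1r. Qed.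

Lemma Tz_0 a : T (z a).
Proof. by have := Tz 1 a T0; rewrite add0r scale1r. Qed.

Local Hint Resolve Tz0_0 Tz_0 : core.

Lemma T_shift X k l : T X -> T (shift X k l).
Proof. by move=> tX; do 3!apply: Tz; apply: Tz0. Qed.

Lemma shift_decompose X : X = shift 0 (x0 X) (x X) +
  1 *: shift X (- x0 X) (fun a => - x X a).
Proof.
rewrite scale1r /shift add0r !scaleNr.
move: (_ *: z0) (_ *: z 0) (_ *: z 1) (_ *: z 2) => A B C D.
have -> : X - A - B - C - D = X - (A + B + C + D) by rewrite !opprD !addrA.
by rewrite addrC subrK.
Qed.

Lemma H_shift X : T X -> H (shift X (- x0 X) (fun a => - x X a)).
Proof.
move=> tX; have t0 := Tz0 (- x0 X) tX.
have t1 := Tz (- x X 0) 0 t0; have t2 := Tz (- x X 1) 1 t1.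
apply/HP; split; first exact: T_shift.
  by rewrite /shift !x0D // x0z0 !x0z !mulr0 !addr0 mulr1 subrr.
rewrite /shift => a; rewrite !xD // xz0 !xz mulr0 addr0.
by move: a; apply: ord3P; rewrite /= ?mulr0 ?mulr1 ?addr0 ?subrr.
Qed.

Context (b : V -> V -> R).
Context (bD : forall k X Y Z, T X -> T Y -> T Z ->
  b (X + k *: Y) Z = b X Z + k * b Y Z).
Context (bC : forall X Y, T X -> T Y -> b X Y = - b Y X).
Context (bHH : forall X Y, H X -> H Y -> b X Y = 0).
Context (bHV : forall X k l, H X -> b X (shift 0 k l) = 0).
Context (bz : forall a, b z0 (z a) = b (z (a + 1)) (z (a + 2))).

Lemma form0l Z : T Z -> b 0 Z = 0.
Proof.
by move=> tZ; have := bD (- 1) T0 T0 tZ; rewrite scaler0 addr0 mulN1r subrr.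
Qed.

Lemma form_shiftl k l Z : T Z ->
  b (shift 0 k l) Z = k * b z0 Z + \sum_a l a * b (z a) Z.
Proof.
move=> tZ; have t0 := Tz0 k T0.
have t1 := Tz (l 0) 0 t0; have t2 := Tz (l 1) 1 t1.
by rewrite /shift !bD // form0l // add0r sum3E !addrA.
Qed.

(** Split [Y] into vertical and horizontal parts; skew-symmetry moves this sum to the first
    argument, where [b] is additive. *)
Lemma form_horizontal X Y : H X -> T Y -> b X Y = 0.
Proof.
move=> hX tY; have [tX _ _] := (HP X).1 hX.
have hY := H_shift tY; have [thY _ _] := (HP _).1 hY.
have tV := T_shift (x0 Y) (x Y) T0.
rewrite bC // (shift_decompose Y) bD //.
by rewrite (bHH hY hX) mulr0 addr0 bC // opprK bHV.
Qed.

Lemma form_vertical X Y : T X -> T Y ->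
  b X Y = x0 X * b z0 Y + \sum_a x X a * b (z a) Y.
Proof.
move=> tX tY; have hX := H_shift tX; have [thX _ _] := (HP _).1 hX.
have tV := T_shift (x0 X) (x X) T0.
rewrite {1}(shift_decompose X) bD // (form_horizontal hX) //.
by rewrite mulr0 addr0 form_shiftl.
Qed.

(** Both arguments are expanded along [z0] and the [z a]: the diagonal values vanish by
    skew-symmetry, and [bz] identifies the six others in pairs. *)
Lemma hermitian_formE X Y : T X -> T Y -> b X Y =
  \sum_a b z0 (z a) * (x0 X * x Y a - x0 Y * x X a
    + (x X (a + 1) * x Y (a + 2) - x X (a + 2) * x Y (a + 1))).
Proof.
move=> tX tY.
have self Z : T Z -> b Z Z = 0.
  move=> tZ; apply/eqP; have /eqP := bC tZ tZ.
  by rewrite -addr_eq0 -mulr2n mulrn_eq0.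
have right Z : T Z -> b Z Y = x0 Y * b Z z0 + \sum_a x Y a * b Z (z a).
  move=> tZ; rewrite bC // form_vertical // opprD -mulrN -bC // -sumrN.
  by congr (_ + _); apply: eq_bigr => a _; rewrite -mulrN -bC.
rewrite form_vertical // sum3E !right // !sum3E !self //.
(* The remaining values are oriented with [z0] first and the [z a] in cyclic order, as [bz] has
   them. *)
rewrite (bC (Tz_0 0) Tz0_0) (bC (Tz_0 1) Tz0_0).
rewrite (bC (Tz_0 2) Tz0_0) (bC (Tz_0 1) (Tz_0 0)) (bC (Tz_0 2) (Tz_0 1)).
rewrite (bC (Tz_0 0) (Tz_0 2)) !bz !add3E.
by ring.
Qed.

End HermitianForms.

(** * Classification of the vertical Hermitian forms *)

Section Classification.
Context {R : realType} {d : nat} {M : manifold R d}.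
Context (Q : M -> set 'M[R]_d) (d_gt0 : (0 < d)%N) (aQ : almost_quaternionic Q).
Context (nabla : connection_op M) (conn : is_connection nabla).
Context (presQ : preserves nabla Q) (u : frame_point M) (su : swann Q u).
Implicit Types (X Y Z : ambient R d) (a c : 'I_3).

Local Notation th := (theta nabla u).

Lemma horizontalP X :
  horizontal Q nabla u X <->
  [/\ tangent Q u X, theta0 u X = 0 & forall a, th X a = 0].
Proof.
split=> [[tX X0 Xth]|[tX X0 Xth]]; split=> //.
  by move=> a; rewrite Xth ffunE.
by apply/ffunP => a; rewrite Xth ffunE.
Qed.

Lemma theta_addr k X Y : tangent Q u X -> tangent Q u Y ->
  forall a, th (X + k *: Y) a = th X a + k * th Y a.
Proof.
move=> /(tangent_theta d_gt0 aQ conn presQ su) hX.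
move=> /(tangent_theta d_gt0 aQ conn presQ su) hY a.
by rewrite addrC (thetaP d_gt0 aQ conn su k hY hX).2 addrC.
Qed.

Lemma shift_vertical k l : vertical Q u (shift (Z0 u) (Zi u) 0 k l).
Proof.
split.
  apply: T_shift; first by move=> k' X; apply: tangent_addZ0.
    by move=> k' a X; apply: tangent_addZi.
  exact: tangent0.
have := dproj_Zi d_gt0 aQ su; have := dproj_Z0 su.
move: (Z0 u) (Zi u) => z0 z z00 zi0.
have dP k' X Y : dproj (X + k' *: Y) = dproj X + k' *: dproj Y by [].
by rewrite /shift !dP !zi0 z00 !scaler0 !addr0.
Qed.

Lemma Ihat_Z0 a : Ihat Q nabla u a (Z0 u) = - Zi u a.
Proof.
rewrite /Ihat (dproj_Z0 su) mulmx0 (hlift0 d_gt0 aQ conn presQ su) addr0.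
rewrite (theta0_Z0 su) (theta_Z0 d_gt0 aQ conn su) scale1r.
move: (Z0 u) (Zi u) => z0 z.
by rewrite ![(0 : {ffun _}) _]ffunE !scale0r !addr0.
Qed.

Lemma Ihat_Zi a : Ihat Q nabla u a (Zi u (a + 1)) = Zi u (a + 2).
Proof.
rewrite /Ihat (dproj_Zi d_gt0 aQ su) mulmx0.
rewrite (hlift0 d_gt0 aQ conn presQ su) addr0 (theta0_Zi d_gt0 aQ su).
rewrite !(theta_Zi d_gt0 aQ conn su (a + 1)) eqxx.
have -> : (a == a + 1) = false by move: a; apply: ord3P.
have -> : (a + 2 == a + 1) = false by move: a; apply: ord3P.
move: (Z0 u) (Zi u) => z0 z.
by rewrite !scale0r scale1r addr0 !add0r.
Qed.

Lemma hermitian_Z0_Zi b : two_form Q u b -> Defs.hermitian Q nabla u b ->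
  forall a, b (Z0 u) (Zi u a) = b (Zi u (a + 1)) (Zi u (a + 2)).
Proof.
move=> [lb sb] hb a; have tZ0 := tangent_Z0 su.
have tZ := tangent_Zi d_gt0 aQ su; have t0 := tangent0 su.
have e1 : a + 2 + 1 = a by rewrite -addrA add3E addr0.
have e2 : a + 2 + 2 = a + 1 by rewrite -addrA add3E.
(* Invariance under [Ihat] of index [a + 2], which sends [Z_0] to [- Z_{a+2}] and [Z_a] to
   [Z_{a+1}], since [a = (a + 2) + 1]. *)
have := etrans (esym (hb (a + 2) _ _ tZ0 (tZ (a + 2 + 1))))
  (congr2 b (Ihat_Z0 (a + 2)) (Ihat_Zi (a + 2))).
move: (Z0 u) (Zi u) tZ0 tZ => z0 z tZ0 tZ; rewrite e1 e2 => ->.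
have b0 Y : tangent Q u Y -> b 0 Y = 0.
  move=> tY; have := lb (- 1) 0 0 Y t0 t0 tY.
  by rewrite scaler0 addr0 mulN1r addNr.
have := lb (- 1) (z (a + 2)) 0 (z (a + 1)) (tZ _) t0 (tZ _).
by rewrite scaleN1r addr0 b0 // addr0 mulN1r -sb // => ->.
Qed.

(** This is [hermitian_formE] for the Swann bundle; the factor [fscale u ^+ 2] compensates the
    [t^-2] of [beta_E]. *)
Lemma vertical_hermitianE b : vertical_hermitian Q nabla u b ->
  forall X Y, tangent Q u X -> tangent Q u Y ->
  b X Y = \sum_a (b (Z0 u) (Zi u a) * fscale u ^+ 2) * beta_ nabla u a X Y.
Proof.
move=> [tb hb bHH bHV] X Y tX tY; have bz := hermitian_Z0_Zi tb hb.
have [lb sb] := tb.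
have x0D k X' Y' : tangent Q u X' -> tangent Q u Y' ->
    theta0 u (X' + k *: Y') = theta0 u X' + k * theta0 u Y'.
  by move=> _ _; rewrite addrC theta0P addrC.
have xz0 a : th (Z0 u) a = 0 by rewrite (theta_Z0 d_gt0 aQ conn su) ffunE.
have bD k X' Y' Z : tangent Q u X' -> tangent Q u Y' -> tangent Q u Z ->
    b (X' + k *: Y') Z = b X' Z + k * b Y' Z.
  by move=> tX' tY' tZ; rewrite addrC lb // addrC.
have bV X' k l : horizontal Q nabla u X' ->
    b X' (shift (Z0 u) (Zi u) 0 k l) = 0.
  by move=> hX; apply: bHV => //; apply: shift_vertical.
rewrite (hermitian_formE (tangent0 su)
  (fun k X' => @tangent_addZ0 _ _ _ _ u X' k su)
  (fun k a X' => @tangent_addZi _ _ _ _ d_gt0 aQ u X' a k su) x0D theta_addr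
  (theta0_Z0 su) (theta0_Zi d_gt0 aQ su) xz0 (theta_Zi d_gt0 aQ conn su)
  horizontalP bD sb bHH bV bz tX tY).
apply: eq_bigr => a _; rewrite (beta_E _ su) -mulrA; congr (_ * _).
by rewrite mulVKf // expf_neq0 // (scale_neq0 su).
Qed.

(** On the pair [Z_0], [Z_a] only the form of index [a] is nonzero, with value [t^-2]. *)
Lemma beta_free (c : 'I_3 -> R) :
  (forall X Y, tangent Q u X -> tangent Q u Y ->
     \sum_a c a * beta_ nabla u a X Y = 0) -> forall a, c a = 0.
Proof.
move=> c0 a.
have := c0 _ _ (tangent_Z0 su) (tangent_Zi d_gt0 aQ su a).
have th0 := theta_Z0 d_gt0 aQ conn su; have thi := theta_Zi d_gt0 aQ conn su.
have t00 := theta0_Z0 su; have t0i := theta0_Zi d_gt0 aQ su.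
under eq_bigr do rewrite (beta_E _ su).
move: (Z0 u) (Zi u) th0 thi t00 t0i => z0 z th0 thi t00 t0i.
rewrite t00 t0i th0 (bigD1 a) //= big1 ?addr0; last first.
  move=> e /negbTE ea; rewrite thi ea ![(0 : {ffun _}) _]ffunE.
  by rewrite !mul0r !mulr0 subrr addr0 !mulr0.
rewrite thi eqxx ![(0 : {ffun _}) _]ffunE.
rewrite !mul0r subrr subr0 addr0 !mulr1 => /eqP.
by rewrite mulf_eq0 invr_eq0 expf_eq0 /= (negbTE (scale_neq0 su)) orbF => /eqP.
Qed.

End Classification.

Theorem proposition3p10 (R : realType) (n : nat) (M : manifold R (4 * n))
    (Q : M -> set 'M[R]_(4 * n)) (w : M -> 'M[R]_(4 * n))
    (nabla : connection_op M) (p : frame_point M) :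
  (1 < n)%N ->
  quaternionic_skew_hermitian Q w ->
  adapted_connection Q w nabla ->
  swann Q p ->
  [/\ forall a, vertical_hermitian Q nabla p (beta_ nabla p a),
      forall b, vertical_hermitian Q nabla p b ->
        exists c : 'I_3 -> R, forall X Y, tangent Q p X -> tangent Q p Y ->
          b X Y = \sum_a c a * beta_ nabla p a X Y &
      forall c : 'I_3 -> R,
        (forall X Y, tangent Q p X -> tangent Q p Y ->
           \sum_a c a * beta_ nabla p a X Y = 0) ->
        forall a, c a = 0].
Proof.
move=> n1 [aQ _ _] [conn _ presQ _] sp.
(* Positivity of the dimension allows the division by [d] in the trace coefficients. *)
have d_gt0 : (0 < 4 * n)%N by rewrite muln_gt0 (ltnW n1).
split.
- by move=> a; apply: beta_vertical_hermitian.
- move=> b vb; exists (fun a => b (Z0 p) (Zi p a) * fscale p ^+ 2) => X Y tX tY.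
  exact: (vertical_hermitianE d_gt0 aQ conn presQ sp vb tX tY).
- by move=> c c0; apply: (beta_free d_gt0 aQ conn sp c0).
Qed.
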